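(* Let $H$ be a separable Hilbert space, $0<p\le2$, and $T$ a bounded linear operator on $H$. The following are equivalent: (a) $T\in S_p$; (b) $\{\|Te_n\|\}\in\ell^p$ for some orthonormal basis $\{e_n\}$ of $H$; (c) $\{\|Tf_n\|\}\in\ell^p$ for some frame $\{f_n\}$ of $H$. Furthermore, $$\|T\|_p^p=\inf\sum_{n=1}^\infty\|Te_n\|^p=\inf\sum_{n=1}^\infty\|f_n\|^{2-p}\|Tf_n\|^p=\inf\sum_{n=1}^\infty\|Tf_n\|^p,$$ where the first infimum is over all orthonormal bases, the second over all frames with lower frame bound at least $1$, and the third over all Parseval frames. (Terms with $f_n=0$ are taken to be $0$.)
   Context: A sequence $\{f_n\}$ in $H$ is a frame if there are constants $0<C_1\le C_2$ such that $C_1\|f\|^2\le\sum_n|\langle f,f_n\rangle|^2\le C_2\|f\|^2$ for all $f\in H$. The upper frame bound is the infimum of all admissible $C_2$. The lower frame bound is the supremum of all admissible $C_1$. A Parseval frame is one whose lower and upper frame bounds both equal $1$. For a compact operator $T$, its singular values $\lambda_1\ge\lambda_2\ge\cdots$ are the positive eigenvalues of $(T^*T)^{1/2}$, repeated according to multiplicity. For $0<p<\infty$, $S_p$ is the set of compact $T$ with $\{\lambda_n\}\in\ell^p$, and $\|T\|_p=(\sum_n\lambda_n^p)^{1/p}$. *)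

(* Defs.v *)
From Stdlib Require Import Reals Lra List Classical.
Open Scope R_scope.

Record C : Type := mkC { Re : R; Im : R }.
Definition C0 : C := mkC 0 0.
Definition C1 : C := mkC 1 0.
Definition RtoC (r : R) : C := mkC r 0.
Definition Cadd (z w : C) : C := mkC (Re z + Re w) (Im z + Im w).
Definition Cmul (z w : C) : C :=
  mkC (Re z * Re w - Im z * Im w) (Re z * Im w + Im z * Re w).
Definition Cconj (z : C) : C := mkC (Re z) (- Im z).
Definition Cmod2 (z : C) : R := Re z * Re z + Im z * Im z.

Record HilbertSpace : Type := {
  hV :> Type;
  vzero : hV;
  vadd : hV -> hV -> hV;
  vopp : hV -> hV;
  vscal : C -> hV -> hV;
  inner : hV -> hV -> C;
  vadd_assoc : forall x y z, vadd x (vadd y z) = vadd (vadd x y) z;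
  vadd_comm : forall x y, vadd x y = vadd y x;
  vadd_0 : forall x, vadd x vzero = x;
  vadd_opp : forall x, vadd x (vopp x) = vzero;
  vscal_1 : forall x, vscal C1 x = x;
  vscal_mul : forall a b x, vscal a (vscal b x) = vscal (Cmul a b) x;
  vscal_addv : forall a x y, vscal a (vadd x y) = vadd (vscal a x) (vscal a y);
  vscal_adds : forall a b x, vscal (Cadd a b) x = vadd (vscal a x) (vscal b x);
  inner_addl : forall x y z, inner (vadd x y) z = Cadd (inner x z) (inner y z);
  inner_scall : forall a x z, inner (vscal a x) z = Cmul a (inner x z);
  inner_conj : forall x y, inner y x = Cconj (inner x y);
  inner_pos : forall x, 0 <= Re (inner x x);
  inner_def : forall x, Re (inner x x) = 0 -> x = vzero;
  complete : forall u : nat -> hV,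
    (forall eps, 0 < eps -> exists N, forall m n, (N <= m)%nat -> (N <= n)%nat ->
        sqrt (Re (inner (vadd (u m) (vopp (u n))) (vadd (u m) (vopp (u n))))) < eps) ->
    exists x, forall eps, 0 < eps -> exists N, forall n, (N <= n)%nat ->
        sqrt (Re (inner (vadd (u n) (vopp x)) (vadd (u n) (vopp x)))) < eps;
  separable : exists d : nat -> hV, forall x eps, 0 < eps -> exists n,
        sqrt (Re (inner (vadd x (vopp (d n))) (vadd x (vopp (d n))))) < eps
}.

Arguments vzero {h}.
Arguments vadd {h}.
Arguments vopp {h}.
Arguments vscal {h}.
Arguments inner {h}.

Section Defs.
Variable H : HilbertSpace.

Definition norm (x : H) : R := sqrt (Re (inner x x)).
Definition vsub (x y : H) : H := vadd x (vopp y).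

(** real powers, with the convention 0^q = 0 (only used for q > 0, or for
    terms that are 0 anyway) *)
Definition rpow (x q : R) : R := if Rlt_dec 0 x then Rpower x q else 0.

Definition fsum {I : Type} (a : I -> R) (l : list I) : R :=
  fold_right (fun i s => a i + s) 0 l.

(** [tsum a s] : the (unordered) sum of the nonnegative family a is finite
    and equals s (supremum of the finite partial sums). *)
Definition tsum {I : Type} (a : I -> R) (s : R) : Prop :=
  is_lub (fun y => exists l : list I, NoDup l /\ y = fsum a l) s.

(** the family is summable (in l^1); for a = |b|^p this is b in l^p *)
Definition summable {I : Type} (a : I -> R) : Prop := exists s, tsum a s.

(** extended-valued sums: [None] stands for +infinity *)
Definition esum {I : Type} (a : I -> R) (v : option R) : Prop :=
  match v with
  | Some s => tsum a s
  | None => ~ summable a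
  end.

Definition ole (u w : option R) : Prop :=
  match u, w with
  | _, None => True
  | None, Some _ => False
  | Some x, Some y => x <= y
  end.

Definition einf (S : option R -> Prop) (v : option R) : Prop :=
  (forall w, S w -> ole v w) /\
  (forall u, (forall w, S w -> ole u w) -> ole u v).

Definition is_glb (S : R -> Prop) (b : R) : Prop :=
  (forall x, S x -> b <= x) /\ (forall c, (forall x, S x -> c <= x) -> c <= b).

Definition bounded_linear (T : H -> H) : Prop :=
  (forall x y, T (vadd x y) = vadd (T x) (T y)) /\
  (forall a x, T (vscal a x) = vscal a (T x)) /\
  (exists M, forall x, norm (T x) <= M * norm x).

Definition converges (u : nat -> H) : Prop :=
  exists x, forall eps, 0 < eps -> exists N, forall n, (N <= n)%nat ->
    norm (vsub (u n) x) < eps.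

Definition compact (T : H -> H) : Prop :=
  forall u : nat -> H, (exists M, forall n, norm (u n) <= M) ->
    exists phi : nat -> nat, (forall n, (phi n < phi (S n))%nat) /\
      converges (fun n => T (u (phi n))).

Definition adjoint (T S : H -> H) : Prop :=
  forall x y, inner (T x) y = inner x (S y).

Definition positive_op (P : H -> H) : Prop :=
  bounded_linear P /\ forall x, Im (inner (P x) x) = 0 /\ 0 <= Re (inner (P x) x).

Definition abs_op (T P : H -> H) : Prop :=
  positive_op P /\ exists S, adjoint T S /\ forall x, P (P x) = S (T x).

Definition vsum (l : list H) : H := fold_right vadd vzero l.

Definition eigenspace_dim (P : H -> H) (mu : R) (k : nat) : Prop :=
  exists u : nat -> H,
    (forall i j, (i < k)%nat -> (j < k)%nat ->
        inner (u i) (u j) = if Nat.eqb i j then C1 else C0) /\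
    (forall i, (i < k)%nat -> P (u i) = vscal (RtoC mu) (u i)) /\
    (forall x, P x = vscal (RtoC mu) x ->
        x = vsum (map (fun i => vscal (inner x (u i)) (u i)) (seq 0 k))).

Definition eigenvalue (P : H -> H) (mu : R) : Prop :=
  exists x, x <> vzero /\ P x = vscal (RtoC mu) x.

(** lam = (lambda_1 >= lambda_2 >= ...) is the sequence of positive
    eigenvalues of P, repeated according to multiplicity (padded with
    zeros if there are only finitely many) *)
Definition sing_vals (P : H -> H) (lam : nat -> R) : Prop :=
  (forall n, 0 <= lam n) /\
  (forall n, lam (S n) <= lam n) /\
  (forall mu, 0 < mu -> (eigenvalue P mu <-> exists n, lam n = mu)) /\
  (forall mu, 0 < mu -> (exists n, lam n = mu) ->
     exists a k, (forall n, lam n = mu <-> (a <= n < a + k)%nat) /\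
                 eigenspace_dim P mu k).

Definition in_Sp (p : R) (T : H -> H) : Prop :=
  compact T /\ exists P lam, abs_op T P /\ sing_vals P lam /\
                  summable (fun n => rpow (lam n) p).

Definition schatten_pow (p : R) (T : H -> H) (v : option R) : Prop :=
  match v with
  | Some s => compact T /\ exists P lam, abs_op T P /\ sing_vals P lam /\
                  tsum (fun n => rpow (lam n) p) s
  | None => ~ in_Sp p T
  end.

Definition ONB {I : Type} (e : I -> H) : Prop :=
  (forall i, inner (e i) (e i) = C1) /\
  (forall i j, i <> j -> inner (e i) (e j) = C0) /\
  (forall x, (forall i, inner x (e i) = C0) -> x = vzero).

Definition frame_ineq (f : nat -> H) (c1 c2 : R) : Prop :=
  forall x, exists s, tsum (fun n => Cmod2 (inner x (f n))) s /\
    c1 * (norm x * norm x) <= s <= c2 * (norm x * norm x).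

Definition frame (f : nat -> H) : Prop :=
  exists c1 c2, 0 < c1 <= c2 /\ frame_ineq f c1 c2.

Definition lower_frame_bound (f : nat -> H) (A : R) : Prop :=
  is_lub (fun c1 => exists c2, 0 < c1 <= c2 /\ frame_ineq f c1 c2) A.

Definition upper_frame_bound (f : nat -> H) (B : R) : Prop :=
  is_glb (fun c2 => exists c1, 0 < c1 <= c2 /\ frame_ineq f c1 c2) B.

(** frame whose lower frame bound is at least 1 (a lower bound equal to
    +infinity, i.e. no lub, also counts) *)
Definition frame_lower_ge1 (f : nat -> H) : Prop :=
  frame f /\ forall A, lower_frame_bound f A -> 1 <= A.

Definition parseval (f : nat -> H) : Prop :=
  frame f /\ lower_frame_bound f 1 /\ upper_frame_bound f 1.

End Defs.

(* Main.v *)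
(** The lower bound for all three infima comes from one inequality.  If [u_k] are
    orthonormal eigenvectors of [|T|] for the singular values [lam_k], Hoelder's
    inequality and Bessel's inequality give, for each vector [f],
    [sum_k lam_k^p |<f,u_k>|^2 <= |f|^(2-p) |T f|^p]; summing over a family [f_n]
    with [c |x|^2 <= sum_n |<x,f_n>|^2] gives
    [c sum_k lam_k^p <= sum_n |f_n|^(2-p) |T f_n|^p].  Equality holds for the [u_k]
    completed by an orthonormal basis of the kernel of [T].
    Conversely, a finite sum on the right makes [T] Hilbert-Schmidt, hence compact;
    the spectral theorem for [T^* T] then provides [|T|] and its eigenvectors, and
    the same inequality bounds [sum_k lam_k^p]. *)

From Stdlib Require Import Reals Lra Lia List FinFun Classical ClassicalEpsilon.
Require Import Defs.
Open Scope R_scope.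

(** A frame enters the estimates only through [lower_bounded], a statement about finite partial
    sums. Orthonormal bases over any index type, frames and Parseval frames all satisfy it, so a
    single inequality serves the three infima. The weight [|f|^(2-p)] is what Hoelder with exponents
    [2/p] and [2/(2-p)] leaves over; for unweighted sums it is controlled by the upper frame bound.
    Two obstacles shape the proof. The space may have finite dimension while eigenvectors come as
    sequences, so families are padded with zero vectors. And [sing_vals] speaks of any [P] and
    [lam], not of the pair built by the spectral theorem: the eigenvectors have to be recovered from
    the eigenspaces, and [P] shown anew to vanish on their complement. A nonzero vector is assumed
    because in the zero space every positive constant is a lower frame constant, so that no Parseval
    frame exists there. *)

Lemma C_ext (z w : C) : Re z = Re w -> Im z = Im w -> z = w.
Proof. destruct z, w; simpl; intros -> ->; reflexivity. Qed.

Lemma Cmod2_ge0 (z : C) : 0 <= Cmod2 z.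
Proof. unfold Cmod2; nra. Qed.

Lemma Cmod2_conj (z : C) : Cmod2 (Cconj z) = Cmod2 z.
Proof. unfold Cmod2; simpl; ring. Qed.

Lemma Cmod2_mul (z w : C) : Cmod2 (Cmul z w) = Cmod2 z * Cmod2 w.
Proof. unfold Cmod2; simpl; ring. Qed.

Lemma Cconj_C0 : Cconj C0 = C0.
Proof. apply C_ext; simpl; ring. Qed.

(** At the minimizer [- b / c] the quadratic equals [(a c - b^2) / c]. When [c = 0] the function is
    affine, and [b <> 0] would give it the value [-1] at [- (a + 1) / (2 b)]. *)
Lemma discriminant_le (a b c : R) :
  0 <= c -> (forall t, 0 <= a + 2 * b * t + c * (t * t)) -> b * b <= a * c.
Proof.
  intros hc h.
  destruct (Req_dec c 0) as [-> | hc0].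
  - destruct (Req_dec b 0) as [-> | hb]; [lra|].
    specialize (h (- (a + 1) / (2 * b))).
    replace (a + 2 * b * (- (a + 1) / (2 * b)) + 0 * _) with (-1) in h by (field; lra).
    lra.
  - specialize (h (- b / c)).
    replace (a + 2 * b * (- b / c) + c * (- b / c * (- b / c)))
      with ((a * c - b * b) / c) in h by (field; lra).
    assert (h2 : 0 <= (a * c - b * b) / c * c) by (apply Rmult_le_pos; lra).
    replace ((a * c - b * b) / c * c) with (a * c - b * b) in h2 by (field; lra).
    lra.
Qed.

Lemma Un_cv_intro (u : nat -> R) (l : R) :
  (forall eps, 0 < eps -> exists N, forall n, (N <= n)%nat -> Rabs (u n - l) < eps) ->
  Un_cv u l.
Proof.
  intros h eps he; destruct (h eps he) as [N hN]; exists N; intros n hn.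
  unfold Rdist; apply hN; lia.
Qed.

Lemma Un_cv_const (c : R) : Un_cv (fun _ => c) c.
Proof.
  intros eps he; exists 0%nat; intros; unfold Rdist.
  replace (c - c) with 0 by ring; rewrite Rabs_R0; lra.
Qed.

Lemma Un_cv_eventually_const (u : nat -> R) (l c : R) (N : nat) :
  Un_cv u l -> (forall n, (N <= n)%nat -> u n = c) -> l = c.
Proof.
  intros hu hc. apply (UL_sequence u); auto.
  intros eps he; exists N; intros n hn; rewrite hc by lia; unfold Rdist.
  replace (c - c) with 0 by ring; rewrite Rabs_R0; lra.
Qed.

(** * Inner products and squared norms *)

Section InnerProduct.
Context {H : HilbertSpace}.
Implicit Types x y z : H.

Lemma inner_addr x y z : inner x (vadd y z) = Cadd (inner x y) (inner x z).
Proof.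
  rewrite (inner_conj _ (vadd y z) x), inner_addl, (inner_conj _ x y), (inner_conj _ x z).
  apply C_ext; simpl; ring.
Qed.

Lemma inner_scalr a x y : inner x (vscal a y) = Cmul (Cconj a) (inner x y).
Proof.
  rewrite (inner_conj _ (vscal a y) x), inner_scall, (inner_conj _ x y).
  apply C_ext; simpl; ring.
Qed.

Lemma inner_0l x : inner vzero x = C0.
Proof.
  assert (h := inner_addl H vzero vzero x). rewrite vadd_0 in h.
  assert (hr := f_equal Re h); assert (hi := f_equal Im h); simpl in *.
  apply C_ext; simpl; lra.
Qed.

Lemma inner_0r x : inner x vzero = C0.
Proof. rewrite inner_conj, inner_0l. apply Cconj_C0. Qed.


Lemma inner_oppl x y : inner (vopp x) y = Cmul (RtoC (-1)) (inner x y).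
Proof.
  assert (h := inner_addl H x (vopp x) y). rewrite vadd_opp, inner_0l in h.
  assert (hr := f_equal Re h); assert (hi := f_equal Im h); simpl in *.
  apply C_ext; simpl; lra.
Qed.

Lemma inner_oppr x y : inner x (vopp y) = Cmul (RtoC (-1)) (inner x y).
Proof.
  rewrite (inner_conj _ (vopp y) x), inner_oppl, (inner_conj _ x y).
  apply C_ext; simpl; ring.
Qed.

Lemma vsub_eq0 x y : vsub H x y = vzero -> x = y.
Proof.
  unfold vsub; intros h.
  rewrite <- (vadd_0 _ x), <- (vadd_opp _ y), (vadd_comm _ y), vadd_assoc, h.
  rewrite vadd_comm; apply vadd_0.
Qed.

Lemma inner_ext x y : (forall z, inner x z = inner y z) -> x = y.
Proof.
  intros h; apply vsub_eq0, inner_def; unfold vsub.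
  rewrite inner_addl, inner_oppl, h; simpl; ring.
Qed.

Definition nsq (x : H) : R := Re (inner x x).

Lemma Re_inner_sym x y : Re (inner y x) = Re (inner x y).
Proof. rewrite inner_conj; reflexivity. Qed.

Lemma Im_inner_sym x y : Im (inner y x) = - Im (inner x y).
Proof. rewrite inner_conj; reflexivity. Qed.

Lemma Im_inner_self x : Im (inner x x) = 0.
Proof. assert (h := Im_inner_sym x x); lra. Qed.

Lemma inner_eq0_sym x y : inner x y = C0 -> inner y x = C0.
Proof. rewrite (inner_conj _ x y); intros ->; apply Cconj_C0. Qed.

Lemma inner_self x : inner x x = RtoC (nsq x).
Proof. apply C_ext; [reflexivity | apply Im_inner_self]. Qed.

Lemma nsq_ge0 x : 0 <= nsq x.
Proof. apply inner_pos. Qed.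

Lemma nsq_eq0 x : nsq x = 0 -> x = vzero.
Proof. apply inner_def. Qed.

Lemma nsq_0 : nsq vzero = 0.
Proof. unfold nsq; rewrite inner_0l; reflexivity. Qed.

Lemma norm_sqr x : norm H x * norm H x = nsq x.
Proof. apply sqrt_sqrt, inner_pos. Qed.

Lemma norm_ge0 x : 0 <= norm H x.
Proof. apply sqrt_pos. Qed.

Lemma norm_0 : norm H vzero = 0.
Proof. unfold norm; rewrite inner_0l; apply sqrt_0. Qed.

End InnerProduct.

Ltac inn := unfold vsub in *;
  repeat first [rewrite inner_addl | rewrite inner_addr | rewrite inner_scall
    | rewrite inner_scalr | rewrite inner_oppl | rewrite inner_oppr
    | rewrite inner_0l | rewrite inner_0r].
Ltac veq := apply inner_ext; intro; inn; apply C_ext; simpl; ring.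

(** * Cauchy-Schwarz, convergence and continuity of the inner product *)

Section Norm.
Context {H : HilbertSpace}.
Implicit Types x y z : H.

Lemma vscal_0l x : vscal C0 x = vzero.
Proof. veq. Qed.

Lemma vscal_0r a : vscal a (@vzero H) = vzero.
Proof. veq. Qed.

Lemma nsq_add x y : nsq (vadd x y) = nsq x + 2 * Re (inner x y) + nsq y.
Proof. unfold nsq; inn; simpl; rewrite (Re_inner_sym x y); ring. Qed.

Lemma nsq_sub x y : nsq (vsub H x y) = nsq x - 2 * Re (inner x y) + nsq y.
Proof. unfold nsq; inn; simpl; rewrite (Re_inner_sym x y); ring. Qed.

Lemma nsq_scal a x : nsq (vscal a x) = Cmod2 a * nsq x.
Proof.
  unfold nsq; inn; unfold Cmod2; simpl; rewrite Im_inner_self; ring.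
Qed.

Lemma nsq_sub_sym x y : nsq (vsub H x y) = nsq (vsub H y x).
Proof. rewrite !nsq_sub, (Re_inner_sym y x); ring. Qed.

Lemma nsq_sub_triangle x y z :
  nsq (vsub H x z) <= 2 * nsq (vsub H x y) + 2 * nsq (vsub H y z).
Proof.
  assert (h := nsq_ge0 (vsub H (vsub H x y) (vsub H y z))).
  rewrite nsq_sub in h.
  replace (vsub H x z) with (vadd (vsub H x y) (vsub H y z)) by veq.
  rewrite nsq_add; lra.
Qed.

(** Expand the squared norm of [|y|^2 x - <x,y> y], the residual of [x] along [y] cleared of
    division. *)
Lemma cauchy_schwarz x y : Cmod2 (inner x y) <= nsq x * nsq y.
Proof.
  destruct (Req_dec (nsq y) 0) as [h0 | h0].
  - apply nsq_eq0 in h0; subst. rewrite inner_0r, nsq_0; unfold Cmod2; simpl; lra.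
  - assert (hy := nsq_ge0 y).
    assert (h := nsq_ge0 (vsub H (vscal (RtoC (nsq y)) x) (vscal (inner x y) y))).
    rewrite nsq_sub, !nsq_scal in h. revert h; inn.
    unfold Cmod2; simpl; intros h.
    assert (h1 : 0 <= nsq y * (nsq x * nsq y - Cmod2 (inner x y)))
      by (unfold Cmod2; nra).
    unfold Cmod2 in *; nra.
Qed.

Lemma Re_inner_le x y : Re (inner x y) * Re (inner x y) <= nsq x * nsq y.
Proof. assert (h := cauchy_schwarz x y); unfold Cmod2 in h; nra. Qed.

(** Distances are squared, hence polynomial in inner products. *)
Definition cvg (u : nat -> H) (x : H) : Prop :=
  forall eps, 0 < eps -> exists N, forall n, (N <= n)%nat -> nsq (vsub H (u n) x) < eps.

Definition cauchy (u : nat -> H) : Prop :=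
  forall eps, 0 < eps -> exists N, forall m n, (N <= m)%nat -> (N <= n)%nat ->
    nsq (vsub H (u m) (u n)) < eps.

Lemma norm_lt_nsq x e : 0 < e -> nsq x < e * e -> norm H x < e.
Proof. intros he h; rewrite <- norm_sqr in h; assert (h0 := norm_ge0 x); nra. Qed.

Lemma nsq_lt_norm x e : 0 < e -> norm H x < sqrt e -> nsq x < e.
Proof.
  intros he h; rewrite <- norm_sqr; assert (h0 := norm_ge0 x).
  rewrite <- (sqrt_sqrt e) by lra; nra.
Qed.

Lemma cauchy_cvg (u : nat -> H) : cauchy u -> exists x, cvg u x.
Proof.
  intros hu. destruct (complete H u) as [x hx].
  - intros eps he; destruct (hu (eps * eps)) as [N hN]; [nra|].
    exists N; intros m n hm hn; apply norm_lt_nsq; auto; apply hN; auto.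
  - exists x; intros eps he. destruct (hx (sqrt eps)) as [N hN].
    + apply sqrt_lt_R0; auto.
    + exists N; intros n hn; apply nsq_lt_norm; auto. apply hN; auto.
Qed.

Lemma cvg_converges (u : nat -> H) : (exists x, cvg u x) <-> converges H u.
Proof.
  split; intros [x hx]; exists x; intros eps he.
  - destruct (hx (eps * eps)) as [N hN]; [nra|].
    exists N; intros n hn; apply norm_lt_nsq; auto; apply hN; auto.
  - destruct (hx (sqrt eps)) as [N hN]; [apply sqrt_lt_R0; auto|].
    exists N; intros n hn; apply nsq_lt_norm; auto.
Qed.

Lemma cvg_cauchy (u : nat -> H) x : cvg u x -> cauchy u.
Proof.
  intros hu eps he; destruct (hu (eps / 4)) as [N hN]; [lra|].
  exists N; intros m n hm hn.
  assert (h := nsq_sub_triangle (u m) x (u n)).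
  assert (h1 := hN m hm); assert (h2 := hN n hn).
  rewrite nsq_sub_sym in h2; lra.
Qed.

Lemma cvg_Re_inner (u : nat -> H) x z :
  cvg u x -> Un_cv (fun n => Re (inner (u n) z)) (Re (inner x z)).
Proof.
  intros hu eps he.
  assert (hz := nsq_ge0 z).
  destruct (hu (eps * eps / (nsq z + 1))) as [N hN].
  { apply Rdiv_lt_0_compat; nra. }
  exists N; intros n hn; unfold Rdist.
  specialize (hN n hn).
  assert (h := Re_inner_le (vsub H (u n) x) z).
  assert (hr : Re (inner (vsub H (u n) x) z) = Re (inner (u n) z) - Re (inner x z))
    by (inn; simpl; ring).
  rewrite hr in h.
  assert (h2 : nsq (vsub H (u n) x) * (nsq z + 1) < eps * eps).
  { apply (Rmult_lt_compat_r (nsq z + 1)) in hN; [|lra].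
    replace (eps * eps / (nsq z + 1) * (nsq z + 1)) with (eps * eps) in hN
      by (field; lra). exact hN. }
  assert (h3 := nsq_ge0 (vsub H (u n) x)).
  set (d := Re (inner (u n) z) - Re (inner x z)) in *.
  apply Rabs_def1; nra.
Qed.

(** Multiplying the second argument by [i] turns imaginary parts into real parts, which carries
    limits of real parts over to imaginary ones. *)
Lemma Im_inner_Re x z : Im (inner x z) = Re (inner x (vscal (mkC 0 1) z)).
Proof. inn; simpl; ring. Qed.

Lemma cvg_Im_inner (u : nat -> H) x z :
  cvg u x -> Un_cv (fun n => Im (inner (u n) z)) (Im (inner x z)).
Proof.
  intros hu. rewrite Im_inner_Re.
  assert (h := cvg_Re_inner u x (vscal (mkC 0 1) z) hu).
  intros eps he; destruct (h eps he) as [N hN]; exists N; intros n hn.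
  rewrite Im_inner_Re; auto.
Qed.

Lemma cvg_inner_eventually (u : nat -> H) x z c N :
  cvg u x -> (forall n, (N <= n)%nat -> inner (u n) z = c) -> inner x z = c.
Proof.
  intros hu hc; apply C_ext.
  - apply (Un_cv_eventually_const _ _ _ N (cvg_Re_inner u x z hu)).
    intros n hn; rewrite hc; auto.
  - apply (Un_cv_eventually_const _ _ _ N (cvg_Im_inner u x z hu)).
    intros n hn; rewrite hc; auto.
Qed.

Lemma cvg_unique (u : nat -> H) x y : cvg u x -> cvg u y -> x = y.
Proof.
  intros hx hy; apply inner_ext; intros z; apply C_ext.
  - apply (UL_sequence _ _ _ (cvg_Re_inner u x z hx) (cvg_Re_inner u y z hy)).
  - apply (UL_sequence _ _ _ (cvg_Im_inner u x z hx) (cvg_Im_inner u y z hy)).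
Qed.

Lemma cvg_nsq_sub (u : nat -> H) x z :
  cvg u x -> Un_cv (fun n => nsq (vsub H (u n) z)) (nsq (vsub H x z)).
Proof.
  intros hu.
  (* [|u - z|^2] is expanded around [x]: one term tends to 0, the other is an inner product linear
     in [u]. *)
  assert (h : Un_cv (fun n => nsq (vsub H (u n) x)
      + (2 * Re (inner (u n) (vsub H x z)) + (nsq z - nsq x))) 
      (0 + (2 * Re (inner x (vsub H x z)) + (nsq z - nsq x)))).
  { apply CV_plus.
    - apply Un_cv_intro; intros eps he; destruct (hu eps he) as [N hN].
      exists N; intros n hn; rewrite Rminus_0_r, Rabs_pos_eq by apply nsq_ge0; auto.
    - apply CV_plus; [|apply Un_cv_const].
      apply CV_mult; [apply Un_cv_const|]. apply cvg_Re_inner; auto. }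
  assert (e : 0 + (2 * Re (inner x (vsub H x z)) + (nsq z - nsq x)) = nsq (vsub H x z)).
  { rewrite nsq_sub; inn; simpl; unfold nsq; ring. }
  rewrite e in h. intros eps he; destruct (h eps he) as [N hN]; exists N; intros n hn.
  specialize (hN n hn).
  replace (nsq (vsub H (u n) z)) with (nsq (vsub H (u n) x)
      + (2 * Re (inner (u n) (vsub H x z)) + (nsq z - nsq x))); auto.
  rewrite !nsq_sub; inn; simpl; unfold nsq; ring.
Qed.

Lemma cvg_nsq (u : nat -> H) x : cvg u x -> Un_cv (fun n => nsq (u n)) (nsq x).
Proof.
  intros hu; assert (h := cvg_nsq_sub u x vzero hu).
  assert (e : forall y, vsub H y vzero = y) by (intros; veq).
  rewrite e in h. intros eps he; destruct (h eps he) as [N hN]; exists N; intros n hn.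
  specialize (hN n hn). rewrite e in hN; auto.
Qed.

Lemma vec_eq0_of_inner_self x : inner x x = C0 -> x = vzero.
Proof. intros h; apply nsq_eq0; unfold nsq; rewrite h; reflexivity. Qed.

End Norm.

Lemma inv_succ_small (eps : R) : 0 < eps ->
  exists N : nat, forall n, (N <= n)%nat -> / (INR n + 1) < eps.
Proof.
  intros he. destruct (archimed_cor1 eps he) as [N [hN hN0]].
  exists N; intros n hn. apply Rlt_trans with (/ INR N); auto.
  apply Rinv_lt_contravar.
  - apply Rmult_lt_0_compat; [apply lt_0_INR; lia|]. assert (h := pos_INR n); lra.
  - apply le_INR in hn; lra.
Qed.

(** * Finite sums and unordered sums of nonnegative families *)

Section FiniteSums.
Context {I : Type}.
Implicit Types (a b : I -> R) (l : list I).

Lemma fsum_le a b l : (forall i, In i l -> a i <= b i) -> fsum a l <= fsum b l.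
Proof.
  induction l as [|i l IH]; simpl; intros h; [lra|].
  assert (h1 := h i (or_introl eq_refl)).
  assert (h2 := IH (fun j hj => h j (or_intror hj))). lra.
Qed.

Lemma fsum_ext a b l : (forall i, In i l -> a i = b i) -> fsum a l = fsum b l.
Proof.
  intros h; apply Rle_antisym; apply fsum_le; intros i hi; rewrite h; auto; lra.
Qed.

Lemma fsum_ge0 a l : (forall i, 0 <= a i) -> 0 <= fsum a l.
Proof. intros h; induction l as [|i l IH]; simpl; [lra|]. specialize (h i); lra. Qed.

Lemma fsum_scal c a l : fsum (fun i => c * a i) l = c * fsum a l.
Proof. induction l as [|i l IH]; simpl; [ring|]. rewrite IH; ring. Qed.

Lemma fsum_add a b l : fsum (fun i => a i + b i) l = fsum a l + fsum b l.
Proof. induction l as [|i l IH]; simpl; [ring|]. rewrite IH; ring. Qed.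

Lemma fsum_app a l1 l2 : fsum a (l1 ++ l2) = fsum a l1 + fsum a l2.
Proof. induction l1 as [|i l IH]; simpl; [ring|]. rewrite IH; ring. Qed.

Lemma fsum_incl a l1 l2 :
  (forall i, 0 <= a i) -> NoDup l1 -> incl l1 l2 -> fsum a l1 <= fsum a l2.
Proof.
  intros ha; revert l2; induction l1 as [|i l1 IH]; intros l2 hn hi.
  - apply fsum_ge0; auto.
  - inversion hn as [|? ? hni hnl]; subst.
    destruct (in_split i l2 (hi i (or_introl eq_refl))) as [m1 [m2 ->]].
    assert (h : incl l1 (m1 ++ m2)).
    { intros j hj. assert (hj2 := hi j (or_intror hj)).
      apply in_app_or in hj2; apply in_or_app.
      destruct hj2 as [h|[h|h]]; auto. subst; contradiction. }
    assert (h2 := IH _ hnl h). rewrite fsum_app in *; simpl; lra.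
Qed.

Definition cnodup l : list I :=
  nodup (fun x y => excluded_middle_informative (x = y)) l.

Lemma cnodup_NoDup l : NoDup (cnodup l).
Proof. apply NoDup_nodup. Qed.

Lemma cnodup_In l i : In i (cnodup l) <-> In i l.
Proof. apply nodup_In. Qed.

Lemma tsum_of_bound a B :
  (forall l, NoDup l -> fsum a l <= B) -> exists s, tsum a s /\ s <= B.
Proof.
  intros h. destruct (completeness (fun y => exists l, NoDup l /\ y = fsum a l)) as [s hs].
  - exists B; intros y [l [hl ->]]; auto.
  - exists 0, nil; split; [constructor | reflexivity].
  - exists s; split; auto. apply hs; intros y [l [hl ->]]; auto.
Qed.

Lemma tsum_le a s l : tsum a s -> NoDup l -> fsum a l <= s.
Proof. intros [h _] hl; apply h; eauto. Qed.

Lemma tsum_approx a s (b : R) : tsum a s -> b < s -> exists l, NoDup l /\ b <= fsum a l.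
Proof.
  intros [_ h] hb. apply NNPP; intros hn.
  enough (s <= b) by lra. apply h; intros y [l [hl ->]].
  destruct (Rle_lt_dec (fsum a l) b); auto.
  exfalso; apply hn; exists l; split; auto; lra.
Qed.

End FiniteSums.

Lemma fsum_swap {I J : Type} (a : I -> J -> R) (l : list I) (m : list J) :
  fsum (fun i => fsum (a i) m) l = fsum (fun j => fsum (fun i => a i j) l) m.
Proof.
  induction l as [|i l IH]; simpl.
  - induction m as [|j m IHm]; simpl; [reflexivity|]. rewrite <- IHm; ring.
  - rewrite IH, fsum_add; reflexivity.
Qed.

Lemma fsum_map {I J : Type} (g : J -> I) (a : I -> R) (l : list J) :
  fsum a (map g l) = fsum (fun j => a (g j)) l.
Proof. induction l as [|j l IH]; simpl; [|rewrite IH]; reflexivity. Qed.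

(** A finite list in [J] is pulled back to [I] after dropping the indices outside the range of [g],
    where [a] vanishes. This serves to delete zero vectors and to pass between [nat] and
    [nat + nat]. *)
Lemma tsum_injection {I J : Type} (g : I -> J) (a : J -> R) (b : I -> R) (s : R) :
  (forall i j, g i = g j -> i = j) -> (forall i, a (g i) = b i) ->
  (forall j, (forall i, g i <> j) -> a j = 0) -> (tsum a s <-> tsum b s).
Proof.
  intros hg hab h0.
  assert (h : forall y, (exists l : list J, NoDup l /\ y = fsum a l) <->
                        (exists l : list I, NoDup l /\ y = fsum b l)).
  { intros y; split; intros [l [hl ->]].
    - enough (h : exists l', NoDup l' /\ (forall i, In i l' -> In (g i) l) /\
                        fsum a l = fsum b l').
      { destruct h as [l' [h1 [_ h2]]]; eauto. }
      induction l as [|j l IH]; [exists nil; split; [constructor|]; split; auto; now intros|].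
      inversion hl; subst. destruct IH as [l' [h1' [h2' h3']]]; auto.
      destruct (classic (exists i, g i = j)) as [[i <-]|hn].
      + exists (i :: l'); split; [|split].
        * constructor; auto.
        * intros k [->|hk]; simpl; auto.
        * simpl; rewrite hab, h3'; reflexivity.
      + exists l'; split; [|split]; simpl; auto.
        rewrite h3', h0; [ring|]. intros i hi; apply hn; eauto.
    - exists (map g l); split.
      + apply Injective_map_NoDup; auto.
      + rewrite fsum_map. apply fsum_ext; auto. }
  unfold tsum, is_lub, is_upper_bound.
  split; intros [h1 h2]; (split; [intros y hy | intros y hy]).
  - apply h1, h; auto.
  - apply h2; intros z hz; apply hy, h; auto.
  - apply h1, h; auto.
  - apply h2; intros z hz; apply hy, h; auto.
Qed.

(** * Bessel, orthogonal projection, Parseval and Riesz-Fischer *)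

Section OrthonormalFamilies.
Context {H : HilbertSpace}.
Implicit Types x y z : H.

(* Zero members are allowed so that finite and infinite families can both be
   indexed by [nat]. *)
Definition orthoz {I : Type} (u : I -> H) : Prop :=
  (forall i, u i = vzero \/ inner (u i) (u i) = C1) /\
  (forall i j, i <> j -> inner (u i) (u j) = C0).

Definition total {I : Type} (u : I -> H) : Prop :=
  forall x, (forall i, inner x (u i) = C0) -> x = vzero.

Definition lsum {I : Type} (c : I -> C) (u : I -> H) (l : list I) : H :=
  vsum H (map (fun i => vscal (c i) (u i)) l).

Lemma lsum_cons {I : Type} (c : I -> C) (u : I -> H) i l :
  lsum c u (i :: l) = vadd (vscal (c i) (u i)) (lsum c u l).
Proof. reflexivity. Qed.

Lemma lsum_app {I : Type} (c : I -> C) (u : I -> H) l1 l2 :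
  lsum c u (l1 ++ l2) = vadd (lsum c u l1) (lsum c u l2).
Proof.
  induction l1 as [|i l IH]; simpl.
  - unfold lsum; simpl; veq.
  - rewrite !lsum_cons, IH; veq.
Qed.

Lemma inner_lsum_0 {I : Type} (c : I -> C) (u : I -> H) l z :
  (forall i, In i l -> inner (u i) z = C0) -> inner (lsum c u l) z = C0.
Proof.
  induction l as [|i l IH]; intros h; [apply inner_0l|].
  rewrite lsum_cons; inn. rewrite IH, h by (simpl in *; auto).
  apply C_ext; simpl; ring.
Qed.

Lemma inner_lsum_in {I : Type} (c : I -> C) (u : I -> H) l j :
  orthoz u -> NoDup l -> In j l ->
  inner (lsum c u l) (u j) = Cmul (c j) (inner (u j) (u j)).
Proof.
  intros [_ hu]; induction l as [|i l IH]; intros hn hj; [contradiction|].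
  inversion hn; subst. rewrite lsum_cons; inn.
  destruct hj as [->|hj].
  - rewrite (inner_lsum_0 c u l).
    + apply C_ext; simpl; ring.
    + intros i hi; apply hu; intros ->; contradiction.
  - rewrite IH by auto. rewrite (hu i j) by (intros ->; contradiction).
    apply C_ext; simpl; ring.
Qed.

Lemma nsq_lsum {I : Type} (c : I -> C) (u : I -> H) l :
  orthoz u -> NoDup l ->
  nsq (lsum c u l) = fsum (fun i => Cmod2 (c i) * nsq (u i)) l.
Proof.
  intros hu; induction l as [|i l IH]; intros hn; [apply nsq_0|].
  inversion hn; subst. rewrite lsum_cons, nsq_add, nsq_scal, IH by auto.
  rewrite Re_inner_sym, inner_scalr, inner_lsum_0.
  - simpl; ring.
  - intros k hk; apply hu; intros ->; contradiction.
Qed.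

Lemma orthoz_inner_self {I : Type} (u : I -> H) x i :
  orthoz u -> Cmul (inner x (u i)) (inner (u i) (u i)) = inner x (u i).
Proof.
  intros [hu _]; destruct (hu i) as [-> | ->].
  - rewrite !inner_0r; apply C_ext; simpl; ring.
  - apply C_ext; simpl; ring.
Qed.

Lemma orthoz_nsq {I : Type} (u : I -> H) i :
  orthoz u -> u i = vzero \/ nsq (u i) = 1.
Proof.
  intros [hu _]; destruct (hu i) as [h|h]; auto.
  right; unfold nsq; rewrite h; reflexivity.
Qed.

Lemma orthoz_nsq_le1 {I : Type} (u : I -> H) i : orthoz u -> nsq (u i) <= 1.
Proof.
  intros hu; destruct (orthoz_nsq u i hu) as [h|h]; rewrite h; [rewrite nsq_0|]; lra.
Qed.

Lemma orthoz_Cmod2 {I : Type} (u : I -> H) x i :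
  orthoz u -> Cmod2 (inner x (u i)) * nsq (u i) = Cmod2 (inner x (u i)).
Proof.
  intros hu; destruct (orthoz_nsq u i hu) as [h|h]; rewrite h.
  - rewrite inner_0r; unfold Cmod2; simpl; ring.
  - ring.
Qed.

Lemma orthoz_residual {I : Type} (u : I -> H) l x j :
  orthoz u -> NoDup l -> In j l ->
  inner (vsub H x (lsum (fun i => inner x (u i)) u l)) (u j) = C0.
Proof.
  intros hu hn hj. inn. rewrite inner_lsum_in, orthoz_inner_self by auto.
  apply C_ext; simpl; ring.
Qed.

(** Pythagoras: the partial sum is orthogonal to the remainder. As the remainder is kept, the
    identity gives error estimates for expansions as well as Bessel's inequality. *)
Lemma bessel_eq {I : Type} (u : I -> H) l x : orthoz u -> NoDup l ->
  nsq x = fsum (fun i => Cmod2 (inner x (u i))) l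
          + nsq (vsub H x (lsum (fun i => inner x (u i)) u l)).
Proof.
  intros hu hn.
  set (y := lsum (fun i => inner x (u i)) u l).
  assert (h : inner y (vsub H x y) = C0).
  { apply inner_lsum_0; intros i hi. apply inner_eq0_sym, orthoz_residual; auto. }
  replace x with (vadd y (vsub H x y)) at 1 by veq.
  rewrite nsq_add, h; simpl.
  unfold y at 1; rewrite nsq_lsum by auto.
  rewrite (fsum_ext _ (fun i => Cmod2 (inner x (u i)))).
  - ring.
  - intros i _; apply orthoz_Cmod2; auto.
Qed.

Lemma bessel {I : Type} (u : I -> H) l x : orthoz u -> NoDup l ->
  fsum (fun i => Cmod2 (inner x (u i))) l <= nsq x.
Proof.
  intros hu hn; rewrite (bessel_eq u l x hu hn).
  assert (h := nsq_ge0 (vsub H x (lsum (fun i => inner x (u i)) u l))); lra.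
Qed.

Inductive span (U : H -> Prop) : H -> Prop :=
| span_0 : span U vzero
| span_cons a u s : U u -> span U s -> span U (vadd (vscal a u) s).

Lemma span_add U x y : span U x -> span U y -> span U (vadd x y).
Proof.
  intros hx hy; induction hx as [|a u s hu hs IH].
  - replace (vadd vzero y) with y by veq; auto.
  - replace (vadd (vadd (vscal a u) s) y) with (vadd (vscal a u) (vadd s y)) by veq.
    constructor; auto.
Qed.

Lemma span_scal U a x : span U x -> span U (vscal a x).
Proof.
  intros hx; induction hx as [|b u s hu hs IH].
  - rewrite vscal_0r; constructor.
  - replace (vscal a (vadd (vscal b u) s)) with (vadd (vscal (Cmul a b) u) (vscal a s))
      by veq.
    constructor; auto.
Qed.

Lemma span_in (U : H -> Prop) x : U x -> span U x.
Proof.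
  intros hx; replace x with (vadd (vscal C1 x) vzero) by veq.
  constructor; auto; constructor.
Qed.

Lemma span_orth (U : H -> Prop) x s :
  (forall u, U u -> inner u x = C0) -> span U s -> inner s x = C0.
Proof.
  intros h hs; induction hs as [|a u s hu hs IH]; inn; [reflexivity|].
  rewrite IH, h by auto; apply C_ext; simpl; ring.
Qed.

Lemma span_projection (U : H -> Prop) x :
  exists (k : nat -> H) y, (forall n, span U (k n)) /\ cvg k y /\
    forall z, U z -> inner (vsub H x y) z = C0.
Proof.
  (* [completeness] provides suprema, so the least squared distance [d] is minus the supremum of the
     negated ones. *)
  destruct (completeness (fun r => exists k, span U k /\ r = - nsq (vsub H k x)))
    as [m [hub hlub]].
  { exists 0; intros r [k [_ ->]]. assert (h := nsq_ge0 (vsub H k x)); lra. }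
  { eexists; exists vzero; split; [constructor | reflexivity]. }
  set (d := - m).
  assert (hd : forall k, span U k -> d <= nsq (vsub H k x)).
  { intros k hk. assert (h : - nsq (vsub H k x) <= m) by (apply hub; eauto).
    unfold d; lra. }
  assert (hk : forall n : nat, exists k, span U k /\ nsq (vsub H k x) < d + / (INR n + 1)).
  { intros n. apply NNPP; intros hn.
    assert (hp : 0 < / (INR n + 1)) by (apply Rinv_0_lt_compat; assert (h := pos_INR n); lra).
    enough (m <= m - / (INR n + 1)) by lra.
    apply hlub; intros r [k [hk ->]].
    destruct (Rlt_le_dec (nsq (vsub H k x)) (d + / (INR n + 1))) as [h|h].
    - exfalso; apply hn; eauto.
    - unfold d in h; lra. }
  destruct (choice _ hk) as [k hk2]; clear hk.
  destruct (cauchy_cvg k) as [y hy].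
  { intros eps he. destruct (inv_succ_small (eps / 4)) as [N hN]; [lra|].
    exists N; intros i j hi hj.
    assert (h1 := proj2 (hk2 i)); assert (h2 := proj2 (hk2 j)).
    assert (h3 := hN i hi); assert (h4 := hN j hj).
    (* The midpoint of [k i] and [k j] is again in the span, hence no closer than [d]. *)
    assert (h5 : d <= nsq (vsub H (vscal (RtoC (/2)) (vadd (k i) (k j))) x)).
    { apply hd, span_scal, span_add; apply hk2. }
    assert (h6 : nsq (vsub H (k i) (k j)) = 2 * nsq (vsub H (k i) x) + 2 * nsq (vsub H (k j) x)
       - 4 * nsq (vsub H (vscal (RtoC (/2)) (vadd (k i) (k j))) x)).
    { rewrite !nsq_sub, nsq_scal, nsq_add; inn; unfold Cmod2; simpl; field. }
    lra. }
  exists k, y; split; [apply hk2 | split; auto].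
  assert (hyd : nsq (vsub H y x) = d).
  { apply (UL_sequence _ _ _ (cvg_nsq_sub k y x hy)).
    apply Un_cv_intro; intros eps he; destruct (inv_succ_small eps he) as [N hN].
    exists N; intros n hn; specialize (hN n hn).
    assert (h1 := hd _ (proj1 (hk2 n))); assert (h2 := proj2 (hk2 n)).
    rewrite Rabs_pos_eq; lra. }
  (* Minimality at [y + t z] for all real [t] makes a quadratic in [t] without constant term
     nonnegative, so its linear coefficient vanishes. *)
  assert (hre : forall z, span U z -> Re (inner (vsub H y x) z) = 0).
  { intros z hz.
    enough (Re (inner (vsub H y x) z) * Re (inner (vsub H y x) z) <= 0 * nsq z) by nra.
    apply discriminant_le; [apply nsq_ge0|]. intros t.
    assert (h : d <= nsq (vsub H y (vsub H x (vscal (RtoC t) z)))).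
    { apply (@Rle_cv_lim (fun _ => d) (fun n => nsq (vsub H (k n) (vsub H x (vscal (RtoC t) z))))).
      - intros n.
        replace (vsub H (k n) (vsub H x (vscal (RtoC t) z)))
          with (vsub H (vadd (k n) (vscal (RtoC t) z)) x) by veq.
        apply hd, span_add; [apply hk2 | apply span_scal; auto].
      - apply Un_cv_const.
      - apply cvg_nsq_sub; auto. }
    replace (vsub H y (vsub H x (vscal (RtoC t) z)))
      with (vadd (vsub H y x) (vscal (RtoC t) z)) in h by veq.
    rewrite nsq_add, nsq_scal, inner_scalr, hyd in h.
    unfold Cmod2 in h; simpl in h. lra. }
  intros z hz.
  assert (h1 := hre z (span_in U z hz)).
  assert (h2 := hre _ (span_scal U (mkC 0 1) z (span_in U z hz))).
  rewrite <- Im_inner_Re in h2. revert h1 h2; inn; simpl; intros h1 h2.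
  apply C_ext; simpl; lra.
Qed.

(** The lower frame inequality through finite partial sums: since [b] stays strictly below
    [c |x|^2], no convergence of the full sum is involved. *)
Definition lower_bounded {I : Type} (f : I -> H) (c : R) : Prop :=
  forall x b, b < c * nsq x ->
    exists l, NoDup l /\ b <= fsum (fun i => Cmod2 (inner x (f i))) l.

(** By totality [x] is a limit of finite combinations of the [u i]. The projection of [x] onto the
    finitely many vectors used is at least as close to [x], so [bessel_eq] on their indices loses
    little. *)
Lemma orthoz_total_lower_bounded {I : Type} (u : I -> H) :
  orthoz u -> total u -> lower_bounded u 1.
Proof.
  intros hu ht x b hb.
  destruct (span_projection (fun z => exists i, z = u i) x) as [k [y [hk [hy hxy]]]].
  assert (e : x = y).
  { apply vsub_eq0, ht; intros i; apply hxy; eauto. }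
  subst y. destruct (hy (nsq x - b)) as [N hN]; [lra|].
  specialize (hN N (le_n N)).
  (* [l] lists the indices occurring in the combination [k N], recorded only through
     orthogonality. *)
  assert (hl : exists l, forall w, (forall i, In i l -> inner (u i) w = C0) ->
                 inner (k N) w = C0).
  { generalize (hk N); generalize (k N); intros s hs.
    induction hs as [|a v s [i ->] hs [l IH]].
    - exists nil; intros; apply inner_0l.
    - exists (i :: l); intros w hw; inn. rewrite IH, hw by (simpl in *; auto).
      apply C_ext; simpl; ring. }
  destruct hl as [l hl]. exists (cnodup l); split; [apply cnodup_NoDup|].
  assert (hb2 := bessel_eq u (cnodup l) x hu (cnodup_NoDup l)).
  set (y := lsum (fun i => inner x (u i)) u (cnodup l)) in *.
  enough (nsq (vsub H x y) <= nsq (vsub H (k N) x)) by lra.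
  assert (h1 : inner (k N) (vsub H x y) = C0).
  { apply hl; intros i hi; apply inner_eq0_sym, orthoz_residual; auto.
    - apply cnodup_NoDup.
    - apply cnodup_In; auto. }
  assert (h2 : inner y (vsub H x y) = C0).
  { apply inner_lsum_0; intros i hi. apply inner_eq0_sym, orthoz_residual; auto.
    apply cnodup_NoDup. }
  assert (e : vsub H (k N) x = vsub H (vsub H (k N) y) (vsub H x y)) by veq.
  rewrite e, (nsq_sub (vsub H (k N) y)).
  assert (h3 : inner (vsub H (k N) y) (vsub H x y) = C0).
  { unfold vsub at 1; rewrite inner_addl, inner_oppl, h1, h2; apply C_ext; simpl; ring. }
  rewrite h3; simpl. assert (h4 := nsq_ge0 (vsub H (k N) y)); lra.
Qed.

Lemma parseval_tsum {I : Type} (u : I -> H) x :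
  orthoz u -> total u -> tsum (fun i => Cmod2 (inner x (u i))) (nsq x).
Proof.
  intros hu ht. split.
  - intros y [l [hl ->]]; apply bessel; auto.
  - intros b hb. destruct (Rle_lt_dec (nsq x) b) as [h|h]; auto.
    destruct (orthoz_total_lower_bounded u hu ht x ((b + nsq x) / 2)) as [l [hl hl2]]; [lra|].
    assert (h2 : fsum (fun i => Cmod2 (inner x (u i))) l <= b) by (apply hb; eauto).
    lra.
Qed.

Lemma in_list_max (l : list nat) n : In n l -> (n < S (list_max l))%nat.
Proof.
  intros hn. assert (h := proj1 (list_max_le l (list_max l)) (le_n _)).
  rewrite Forall_forall in h; specialize (h n hn); lia.
Qed.

Lemma expansion_cvg (u : nat -> H) x : orthoz u -> total u ->
  cvg (fun N => lsum (fun i => inner x (u i)) u (seq 0 N)) x.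
Proof.
  intros hu ht eps he.
  destruct (orthoz_total_lower_bounded u hu ht x (nsq x - eps / 2)) as [l [hl hl2]]; [lra|].
  exists (S (list_max l)); intros n hn.
  rewrite nsq_sub_sym.
  assert (hb := bessel_eq u (seq 0 n) x hu (seq_NoDup _ _)).
  assert (hi : fsum (fun i => Cmod2 (inner x (u i))) l
               <= fsum (fun i => Cmod2 (inner x (u i))) (seq 0 n)).
  { apply fsum_incl; auto.
    - intros; apply Cmod2_ge0.
    - intros i hil; apply in_seq. apply in_list_max in hil; lia. }
  lra.
Qed.

(** The squared distance of two partial sums is an increment of the bounded increasing sequence [s],
    whose weights [nsq (u i)] account for zero members. *)
Lemma riesz_fischer (u : nat -> H) (c : nat -> C) B : orthoz u ->
  (forall N, fsum (fun i => Cmod2 (c i)) (seq 0 N) <= B) ->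
  exists y, cvg (fun N => lsum c u (seq 0 N)) y.
Proof.
  intros hu hB. apply cauchy_cvg.
  set (s := fun N => fsum (fun i => Cmod2 (c i) * nsq (u i)) (seq 0 N)).
  assert (hpos : forall i, 0 <= Cmod2 (c i) * nsq (u i))
    by (intros; apply Rmult_le_pos; [apply Cmod2_ge0 | apply nsq_ge0]).
  destruct (growing_cv s) as [v hv].
  { intros n; unfold s. rewrite seq_S, fsum_app; simpl. specialize (hpos n); lra. }
  { exists B; intros r [N ->]. eapply Rle_trans; [|apply (hB N)].
    apply fsum_le; intros i _.
    assert (h := orthoz_nsq_le1 u i hu); assert (h2 := Cmod2_ge0 (c i)); nra. }
  assert (hd : forall m n, (m <= n)%nat ->
    nsq (vsub H (lsum c u (seq 0 n)) (lsum c u (seq 0 m))) = s n - s m).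
  { intros m n hmn. replace n with (m + (n - m))%nat by lia.
    unfold s; rewrite seq_app, lsum_app, fsum_app; simpl.
    rewrite <- nsq_lsum by (auto using seq_NoDup).
    replace (vsub H (vadd (lsum c u (seq 0 m)) (lsum c u (seq m (n - m)))) (lsum c u (seq 0 m)))
      with (lsum c u (seq m (n - m))) by veq.
    rewrite !nsq_lsum by (auto using seq_NoDup). ring. }
  intros eps he; destruct (hv (eps / 2)) as [N hN]; [lra|].
  exists N; intros m n hm hn.
  assert (h1 := hN m ltac:(lia)); assert (h2 := hN n ltac:(lia)).
  unfold Rdist in *. apply Rabs_def2 in h1; apply Rabs_def2 in h2.
  destruct (Nat.le_ge_cases m n) as [h|h].
  - rewrite nsq_sub_sym, hd by auto; lra.
  - rewrite hd by auto; lra.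
Qed.

Lemma cvg_lsum_inner (u : nat -> H) (c : nat -> C) y k : orthoz u ->
  cvg (fun N => lsum c u (seq 0 N)) y -> inner y (u k) = Cmul (c k) (inner (u k) (u k)).
Proof.
  intros hu hy. apply (cvg_inner_eventually _ _ _ _ (S k) hy).
  intros n hn; apply inner_lsum_in; auto; [apply seq_NoDup | apply in_seq; lia].
Qed.

Lemma cvg_lsum_orth (u : nat -> H) (c : nat -> C) y z :
  cvg (fun N => lsum c u (seq 0 N)) y -> (forall i, inner z (u i) = C0) -> inner y z = C0.
Proof.
  intros hy hz. apply (cvg_inner_eventually _ _ _ _ 0 hy).
  intros n _; apply inner_lsum_0; intros; apply inner_eq0_sym; auto.
Qed.

End OrthonormalFamilies.

(** * Gram-Schmidt completion of orthonormal families *)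

Section Extension.
Context {H : HilbertSpace}.
Implicit Types x y z : H.

Lemma dense_orth (d : nat -> H) z :
  (forall x eps, 0 < eps -> exists n, norm H (vsub H x (d n)) < eps) ->
  (forall n, inner z (d n) = C0) -> z = vzero.
Proof.
  intros hd hz. apply nsq_eq0. assert (h0 := nsq_ge0 z).
  destruct (Rle_lt_or_eq_dec 0 (nsq z) h0) as [h|h]; auto.
  destruct (hd z (sqrt (nsq z))) as [n hn]; [apply sqrt_lt_R0; auto|].
  apply nsq_lt_norm in hn; auto.
  rewrite nsq_sub, hz in hn; simpl in hn. assert (h1 := nsq_ge0 (d n)); lra.
Qed.

(** [g] is the normalized residual of [x] against the closed span of [U], or zero if the residual is
    zero. The last clause is what totality of the final family will rest on. *)
Lemma gram_schmidt_step (U : H -> Prop) x : exists g,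
  (forall u, U u -> inner g u = C0) /\ (g = vzero \/ inner g g = C1) /\
  forall z, (forall u, U u -> inner z u = C0) -> inner z g = C0 -> inner z x = C0.
Proof.
  destruct (span_projection U x) as [k [y [hk [hy hxy]]]].
  assert (hzy : forall z, (forall u, U u -> inner z u = C0) -> inner z y = C0).
  { intros z hz; apply inner_eq0_sym.
    apply (cvg_inner_eventually _ _ _ _ 0 hy); intros n _.
    apply (span_orth U); auto. intros u hu; apply inner_eq0_sym; auto. }
  set (w := vsub H x y).
  assert (hx : forall z, inner z x = Cadd (inner z y) (inner z w))
    by (intros; unfold w; inn; apply C_ext; simpl; ring).
  destruct (Req_dec (nsq w) 0) as [h0|h0].
  - exists vzero; split; [|split].
    + intros; apply inner_0l.
    + auto.
    + intros z hz _. rewrite hx, hzy, (nsq_eq0 w h0), inner_0r by auto.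
      apply C_ext; simpl; ring.
  - assert (hw : 0 < nsq w) by (assert (h := nsq_ge0 w); lra).
    assert (hs := sqrt_lt_R0 _ hw).
    exists (vscal (RtoC (/ sqrt (nsq w))) w); split; [|split].
    + intros u hu; rewrite inner_scall; unfold w; rewrite hxy by auto.
      apply C_ext; simpl; ring.
    + right. rewrite inner_self, nsq_scal; unfold Cmod2; simpl.
      apply C_ext; simpl; auto. rewrite Rmult_0_l, Rplus_0_r.
      rewrite <- (sqrt_sqrt (nsq w)) at 3 by lra. field; lra.
    + intros z hz hg. rewrite inner_scalr in hg.
      assert (hzw : inner z w = C0).
      { assert (h1 := f_equal Re hg); assert (h2 := f_equal Im hg); simpl in *.
        assert (hi : / sqrt (nsq w) <> 0) by (apply Rinv_neq_0_compat; lra).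
        apply C_ext; simpl; nra. }
      rewrite hx, hzy, hzw by auto. apply C_ext; simpl; ring.
Qed.

(** Gram-Schmidt on a dense sequence, each step orthogonalizing also against the whole of [u]. A
    vector orthogonal to the result is orthogonal to the dense sequence. The index type [nat + nat]
    keeps [u] apart from the added vectors, on which [T] will vanish. *)
Lemma orthoz_extension_sum (u : nat -> H) : orthoz u ->
  exists g : nat -> H,
    let w := fun s : nat + nat => match s with inl k => u k | inr k => g k end in
    orthoz w /\ total w.
Proof.
  intros hu. destruct (separable H) as [d hd].
  set (U := fun (L : list H) (x : H) => (exists k, x = u k) \/ In x L).
  destruct (choice (fun (q : list H * nat) g =>
    (forall v, U (fst q) v -> inner g v = C0) /\ (g = vzero \/ inner g g = C1) /\
    forall z, (forall v, U (fst q) v -> inner z v = C0) -> inner z g = C0 ->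
      inner z (d (snd q)) = C0)) as [F hF].
  { intros [L n]; exact (gram_schmidt_step (U L) (d n)). }
  (* [G n] lists the vectors produced in the first [n] steps; step [n] treats [d n]. *)
  set (G := fix G n := match n with O => nil | S m => F (G m, m) :: G m end).
  set (g := fun n => F (G n, n)).
  assert (hin : forall m n, (m < n)%nat -> In (g m) (G n)).
  { intros m n h; induction h; simpl; auto. }
  assert (hin2 : forall n x, In x (G n) -> exists m, x = g m).
  { induction n as [|n IH]; simpl; intros x hx; [contradiction|].
    destruct hx as [<-|hx]; [exists n; reflexivity | auto]. }
  assert (hgu : forall n k, inner (g n) (u k) = C0).
  { intros n k; apply (proj1 (hF (G n, n))). left; eauto. }
  assert (hgg : forall m n, (m < n)%nat -> inner (g n) (g m) = C0).
  { intros m n h; apply (proj1 (hF (G n, n))). right; simpl; auto. }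
  exists g; split; [split|].
  - intros [k|k]; [apply hu|]. apply (proj1 (proj2 (hF (G k, k)))).
  - intros [i|i] [j|j] hij.
    + apply hu; congruence.
    + apply inner_eq0_sym; auto.
    + auto.
    + destruct (Nat.lt_trichotomy i j) as [h|[->|h]].
      * apply inner_eq0_sym; auto.
      * congruence.
      * auto.
  - intros z hz. apply (dense_orth d); auto.
    intros n. apply (proj2 (proj2 (hF (G n, n)))).
    + intros v [[k ->]|hv].
      * apply (hz (inl k)).
      * simpl in hv; destruct (hin2 _ _ hv) as [m ->]. apply (hz (inr m)).
    + apply (hz (inr n)).
Qed.

Lemma orthoz_reindex {I J : Type} (b : J -> I) (u : I -> H) :
  (forall i j, b i = b j -> i = j) -> orthoz u -> orthoz (fun j => u (b j)).
Proof. intros hb [h1 h2]; split; auto. Qed.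

Definition nat_split (n : nat) : nat + nat :=
  if Nat.even n then inl (Nat.div2 n) else inr (Nat.div2 n).

Lemma nat_split_inj m n : nat_split m = nat_split n -> m = n.
Proof.
  intros h. assert (em := Nat.div2_odd m). assert (en := Nat.div2_odd n).
  unfold nat_split in h. rewrite <- Nat.negb_even in em, en.
  destruct (Nat.even m), (Nat.even n); simpl in em, en; inversion h; lia.
Qed.

Lemma nat_split_surj s : exists n, nat_split n = s.
Proof.
  destruct s as [k|k]; unfold nat_split.
  - exists (2 * k)%nat. rewrite Nat.even_mul; simpl Nat.even; simpl orb; cbv iota.
    f_equal; apply Nat.div2_double.
  - exists (S (2 * k)). rewrite Nat.even_succ, Nat.odd_mul; simpl Nat.odd; simpl andb; cbv iota.
    f_equal; apply Nat.div2_succ_double.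
Qed.

Lemma orthoz_total_exists : exists e : nat -> H, orthoz e /\ total e.
Proof.
  destruct (orthoz_extension_sum (fun _ => vzero)) as [g [hg1 hg2]].
  { split; auto. intros; apply inner_0l. }
  exists g; split.
  - apply (orthoz_reindex (fun j => @inr nat nat j) _) in hg1; auto. congruence.
  - intros x hx; apply hg2; intros [k|k]; auto. apply inner_0r.
Qed.

End Extension.

(** * Bounded operators and adjoints *)

Section Adjoint.
Context {H : HilbertSpace}.
Implicit Types x y z : H.
Implicit Types T S : H -> H.

Definition linear T : Prop :=
  (forall x y, T (vadd x y) = vadd (T x) (T y)) /\
  (forall a x, T (vscal a x) = vscal a (T x)).

(** The constant bounds squared norms; positivity permits dividing by it. *)
Definition nsq_bounded T (K : R) : Prop := 0 < K /\ forall x, nsq (T x) <= K * nsq x.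

Lemma bounded_linear_nsq T : bounded_linear H T -> linear T /\ exists K, nsq_bounded T K.
Proof.
  intros [h1 [h2 [M hM]]]; split; [split; auto|].
  exists (M * M + 1); split; [nra|]. intros x; specialize (hM x).
  assert (h3 := norm_ge0 (T x)); assert (h4 := norm_ge0 x).
  assert (h5 : norm H (T x) * norm H (T x) <= (M * norm H x) * (M * norm H x))
    by (apply Rmult_le_compat; auto).
  rewrite norm_sqr in h5.
  replace (M * norm H x * (M * norm H x)) with (M * M * (norm H x * norm H x)) in h5 by ring.
  rewrite norm_sqr in h5. assert (h6 := nsq_ge0 x); nra.
Qed.

Lemma norm_le_of_nsq x y K : 0 < K -> nsq x <= K * nsq y -> norm H x <= sqrt K * norm H y.
Proof.
  intros hK h. unfold norm. rewrite <- sqrt_mult by (try apply inner_pos; lra).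
  apply sqrt_le_1_alt; auto.
Qed.

Lemma nsq_bounded_linear T K : linear T -> nsq_bounded T K -> bounded_linear H T.
Proof.
  intros [h1 h2] [hK h]; split; [auto|split; auto].
  exists (sqrt K); intros x; apply norm_le_of_nsq; auto.
Qed.

Lemma linear_0 T : linear T -> T vzero = vzero.
Proof.
  intros [_ h]. rewrite <- (vscal_0l vzero) at 1. rewrite h; apply vscal_0l.
Qed.

Lemma linear_sub T x y : linear T -> T (vsub H x y) = vsub H (T x) (T y).
Proof.
  intros [h1 h2].
  replace (vsub H x y) with (vadd x (vscal (RtoC (-1)) y)) by veq.
  rewrite h1, h2; veq.
Qed.

Lemma cvg_bounded T K u x : linear T -> nsq_bounded T K ->
  cvg u x -> cvg (fun n => T (u n)) (T x).
Proof.
  intros hT [hK hb] hu eps he. destruct (hu (eps / K)) as [N hN].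
  { apply Rdiv_lt_0_compat; auto. }
  exists N; intros n hn. rewrite <- linear_sub by auto.
  eapply Rle_lt_trans; [apply hb|]. specialize (hN n hn).
  apply (Rmult_lt_compat_l K) in hN; auto.
  replace (K * (eps / K)) with eps in hN by (field; lra). auto.
Qed.

Lemma inner_ext_r x y : (forall z, inner z x = inner z y) -> x = y.
Proof.
  intros h; apply inner_ext; intros z. rewrite (inner_conj _ z x), (inner_conj _ z y), h; auto.
Qed.

Lemma cvg_inner_eq (u v : nat -> H) x y a b : cvg u x -> cvg v y ->
  (forall n, inner (u n) a = inner (v n) b) -> inner x a = inner y b.
Proof.
  intros hu hv h; apply C_ext.
  - apply (UL_sequence _ _ _ (cvg_Re_inner u x a hu)).
    intros eps he; destruct (cvg_Re_inner v y b hv eps he) as [N hN].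
    exists N; intros n hn; rewrite h; auto.
  - apply (UL_sequence _ _ _ (cvg_Im_inner u x a hu)).
    intros eps he; destruct (cvg_Im_inner v y b hv eps he) as [N hN].
    exists N; intros n hn; rewrite h; auto.
Qed.

(** Riesz representation by coordinates: the representing vector is [sum_k c_k e_k] with
    [c_k = <y, T e_k>]. Pairing [y] with the image under [T] of a partial sum gives
    [s^2 <= |y|^2 K s], where [s] is the partial sum of [|c_k|^2]; this bounds [s]. *)
Lemma adjoint_exists T K : linear T -> nsq_bounded T K -> exists S, adjoint H T S.
Proof.
  intros hT hK. destruct (@orthoz_total_exists H) as [e [he ht]].
  assert (h : forall y, exists y', forall x, inner (T x) y = inner x y').
  { intros y. set (c := fun k => inner y (T (e k))).
    assert (hc : forall l, Re (inner y (T (lsum c e l))) = fsum (fun k => Cmod2 (c k)) l).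
    { induction l as [|k l IH].
      - unfold lsum; simpl; rewrite linear_0, inner_0r by auto; reflexivity.
      - rewrite lsum_cons, (proj1 hT), (proj2 hT), inner_addr, inner_scalr; simpl.
        rewrite IH; fold (c k); unfold Cmod2; ring. }
    destruct (riesz_fischer e c (K * nsq y) he) as [y' hy'].
    { intros N. set (s := fsum (fun k => Cmod2 (c k)) (seq 0 N)).
      assert (h1 := Re_inner_le y (T (lsum c e (seq 0 N)))).
      rewrite hc in h1; fold s in h1.
      assert (h2 : nsq (lsum c e (seq 0 N)) <= s).
      { rewrite nsq_lsum by (auto using seq_NoDup). apply fsum_le; intros i _.
        assert (h3 := orthoz_nsq_le1 e i he); assert (h4 := Cmod2_ge0 (c i)); nra. }
      destruct hK as [hK1 hK2]. assert (h3 := hK2 (lsum c e (seq 0 N))).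
      assert (h4 := nsq_ge0 y).
      assert (h5 : 0 <= s) by (apply fsum_ge0; intros; apply Cmod2_ge0).
      assert (h6 : s * s <= nsq y * (K * s)).
      { eapply Rle_trans; [apply h1|]. apply Rmult_le_compat_l; auto.
        eapply Rle_trans; [apply h3|]. apply Rmult_le_compat_l; lra. }
      destruct (Req_dec s 0) as [h7|h7]; [rewrite h7; nra|].
      apply (Rmult_le_reg_l s); [lra|]. nra. }
    exists y'; intros x.
    (* Both sides are continuous in [x], so equality is checked on the partial sums of its
       expansion. *)
    apply (cvg_inner_eq (fun N => T (lsum (fun i => inner x (e i)) e (seq 0 N)))
                        (fun N => lsum (fun i => inner x (e i)) e (seq 0 N))).
    - apply (cvg_bounded T K); auto. apply expansion_cvg; auto.
    - apply expansion_cvg; auto.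
    - intros N; generalize (seq 0 N); induction l as [|k l IH].
      + unfold lsum; simpl; rewrite linear_0, !inner_0l by auto; reflexivity.
      + rewrite lsum_cons, (proj1 hT), (proj2 hT), !inner_addl, !inner_scall, IH.
        do 2 f_equal. rewrite (inner_conj _ y' (e k)), (cvg_lsum_inner e c y' k he hy').
        rewrite (inner_conj _ y (T (e k))). f_equal.
        destruct he as [he _]; destruct (he k) as [h0|h0]; unfold c; rewrite h0.
        * rewrite linear_0, inner_0r by auto. apply C_ext; simpl; ring.
        * apply C_ext; simpl; ring. }
  destruct (choice _ h) as [S hS]. exists S; intros x y; apply hS.
Qed.

Lemma adjoint_sym T S x y : adjoint H T S -> inner (S x) y = inner x (T y).
Proof.
  intros h. rewrite (inner_conj _ y (S x)), <- h, (inner_conj _ (T y) x). reflexivity.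
Qed.

Lemma adjoint_linear T S : adjoint H T S -> linear S.
Proof.
  intros h; split.
  - intros x y; apply inner_ext_r; intros z.
    rewrite inner_addr, <- !h, inner_addr; reflexivity.
  - intros a x; apply inner_ext_r; intros z.
    rewrite inner_scalr, <- !h, inner_scalr; reflexivity.
Qed.

(** [|S y|^4 = <T S y, y>^2 <= K |S y|^2 |y|^2], after which [|S y|^2] is cancelled. *)
Lemma adjoint_bounded T S K : adjoint H T S -> nsq_bounded T K -> nsq_bounded S K.
Proof.
  intros h [hK hb]; split; auto. intros y.
  assert (h1 := Re_inner_le (T (S y)) y).
  rewrite h in h1. fold (nsq (S y)) in h1.
  assert (h2 := hb (S y)). assert (h3 := nsq_ge0 y); assert (h4 := nsq_ge0 (S y)).
  destruct (Req_dec (nsq (S y)) 0) as [h5|h5]; [rewrite h5; nra|].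
  apply (Rmult_le_reg_l (nsq (S y))); [lra|].
  eapply Rle_trans; [apply h1|].
  apply Rle_trans with (K * nsq (S y) * nsq y); [apply Rmult_le_compat_r; auto|].
  apply Req_le; ring.
Qed.

End Adjoint.

(** * Compactness of Hilbert-Schmidt operators *)

Section Compactness.
Context {H : HilbertSpace}.
Implicit Types x y z : H.
Implicit Types T S : H -> H.

(** Subsequences are carried as unbounded sets of indices, which refine without composing maps. *)
Definition infinite (J : nat -> Prop) : Prop := forall N, exists n, (N <= n)%nat /\ J n.

(** Pigeonhole on [k] intervals of length [eps], peeled off one at a time. *)
Lemma infinite_refine_R (r : nat -> R) (eps : R) (k : nat) : 0 < eps ->
  forall (a : R) (J : nat -> Prop), infinite J ->
  (forall n, J n -> a <= r n <= a + INR k * eps) ->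
  exists J', infinite J' /\ (forall n, J' n -> J n) /\
    forall i j, J' i -> J' j -> Rabs (r i - r j) <= eps.
Proof.
  intros he; induction k as [|k IH]; intros a J hJ ha.
  - exists J; split; [auto|split; auto]. intros i j hi hj.
    assert (h1 := ha i hi); assert (h2 := ha j hj). simpl in *.
    apply Rabs_le; lra.
  - destruct (classic (infinite (fun n => J n /\ r n <= a + eps))) as [h|h].
    + exists (fun n => J n /\ r n <= a + eps); split; [auto|split; [now intros n []|]].
      intros i j [hi hi2] [hj hj2]. assert (h1 := ha i hi); assert (h2 := ha j hj).
      apply Rabs_le; lra.
    (* No index from [N] on falls into the lowest interval, so the earlier ones are discarded and
       [k] intervals remain. *)
    + apply not_all_ex_not in h; destruct h as [N hN].
      destruct (IH (a + eps) (fun n => J n /\ (N <= n)%nat)) as [J' [h1 [h2 h3]]].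
      * intros M. destruct (hJ (Nat.max M N)) as [n [hn hn2]].
        exists n; split; [lia|split; auto; lia].
      * intros n [hn hn2]. assert (h1 := ha n hn). rewrite S_INR in h1.
        split; [|lra]. destruct (Rle_lt_dec (a + eps) (r n)); auto.
        exfalso; apply hN; exists n; split; [auto|split; auto; lra].
      * exists J'; split; [auto|split; auto]. intros n hn; apply h2; auto.
Qed.

Lemma infinite_refine_bounded (r : nat -> R) (B eps : R) (J : nat -> Prop) : 0 < eps ->
  infinite J -> (forall n, r n * r n <= B) ->
  exists J', infinite J' /\ (forall n, J' n -> J n) /\
    forall i j, J' i -> J' j -> (r i - r j) * (r i - r j) <= eps.
Proof.
  intros he hJ hB.
  assert (hB0 : 0 <= B) by (specialize (hB 0%nat); nra).
  assert (hs := sqrt_lt_R0 _ he).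
  destruct (INR_unbounded (2 * (B + 1) / sqrt eps)) as [k hk].
  destruct (infinite_refine_R r (sqrt eps) k hs (- (B + 1)) J hJ) as [J' [h1 [h2 h3]]].
  - intros n _. specialize (hB n).
    assert (2 * (B + 1) < INR k * sqrt eps).
    { apply (Rmult_lt_compat_r (sqrt eps)) in hk; auto.
      replace (2 * (B + 1) / sqrt eps * sqrt eps) with (2 * (B + 1)) in hk by (field; lra).
      auto. }
    split; nra.
  - exists J'; split; [auto|split; auto]. intros i j hi hj; specialize (h3 i j hi hj).
    rewrite <- (sqrt_sqrt eps) by lra.
    assert (h4 : Rabs (r i - r j) * Rabs (r i - r j) <= sqrt eps * sqrt eps).
    { apply Rmult_le_compat; auto using Rabs_pos. }
    rewrite <- Rabs_mult, Rabs_pos_eq in h4; [exact h4 | exact (Rle_0_sqr (r i - r j))].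
Qed.

Lemma infinite_refine_coords {I : Type} (e : I -> H) (y : nat -> H) (B eps : R) (l : list I) :
  (forall i, nsq (e i) <= 1) -> (forall n, nsq (y n) <= B) -> 0 < eps ->
  forall J, infinite J -> exists J', infinite J' /\ (forall n, J' n -> J n) /\
    forall i j, J' i -> J' j ->
      fsum (fun k => Cmod2 (inner (vsub H (y i) (y j)) (e k))) l <= eps.
Proof.
  intros he hy. revert eps; induction l as [|k l IH]; intros eps heps J hJ.
  - exists J; split; [auto|split; auto]. intros; simpl; lra.
  - destruct (IH (eps / 2) ltac:(lra) J hJ) as [J1 [h1 [h2 h3]]].
    assert (hc : forall n, Cmod2 (inner (y n) (e k)) <= B).
    { intros n. assert (h := cauchy_schwarz (y n) (e k)).
      assert (h4 := he k); assert (h5 := hy n); assert (h6 := nsq_ge0 (y n)). nra. }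
    destruct (infinite_refine_bounded (fun n => Re (inner (y n) (e k))) B (eps / 4) J1)
      as [J2 [h4 [h5 h6]]]; [lra | auto | |].
    { intros n; specialize (hc n); unfold Cmod2 in hc; nra. }
    destruct (infinite_refine_bounded (fun n => Im (inner (y n) (e k))) B (eps / 4) J2)
      as [J3 [h7 [h8 h9]]]; [lra | auto | |].
    { intros n; specialize (hc n); unfold Cmod2 in hc; nra. }
    exists J3; split; [auto|split; auto]. intros i j hi hj; simpl.
    assert (a1 := h3 i j (h5 _ (h8 _ hi)) (h5 _ (h8 _ hj))).
    assert (a2 := h6 i j (h8 _ hi) (h8 _ hj)). assert (a3 := h9 i j hi hj).
    assert (a4 : Cmod2 (inner (vsub H (y i) (y j)) (e k)) =
      (Re (inner (y i) (e k)) - Re (inner (y j) (e k))) *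
      (Re (inner (y i) (e k)) - Re (inner (y j) (e k))) +
      (Im (inner (y i) (e k)) - Im (inner (y j) (e k))) *
      (Im (inner (y i) (e k)) - Im (inner (y j) (e k)))).
    { inn; unfold Cmod2; simpl; ring. }
    lra.
Qed.

Lemma strict_mono_ge (phi : nat -> nat) : (forall n, (phi n < phi (S n))%nat) ->
  forall n, (n <= phi n)%nat.
Proof. intros h n; induction n as [|n IH]; [lia|]. specialize (h n); lia. Qed.

(** Diagonal argument: the nested sets [G n] have squared diameter at most [1 / (n + 1)], and
    [phi n] is taken from [G n] above the previous index. *)
Lemma totally_bounded_subsequence (y : nat -> H) :
  (forall eps, 0 < eps -> forall J, infinite J -> exists J', infinite J' /\
     (forall n, J' n -> J n) /\
     forall i j, J' i -> J' j -> nsq (vsub H (y i) (y j)) <= eps) ->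
  exists phi : nat -> nat, (forall n, (phi n < phi (S n))%nat) /\
    exists x, cvg (fun n => y (phi n)) x.
Proof.
  intros h.
  destruct (choice (fun (q : (nat -> Prop) * nat) (J' : nat -> Prop) =>
    infinite (fst q) -> infinite J' /\ (forall n, J' n -> fst q n) /\
     forall i j, J' i -> J' j -> nsq (vsub H (y i) (y j)) <= / INR (S (snd q)))) as [F hF].
  { intros [J n]. destruct (classic (infinite J)) as [hJ|hJ].
    - destruct (h (/ INR (S n))) with (J := J) as [J' hJ']; auto.
      + apply Rinv_0_lt_compat, lt_0_INR; lia.
      + exists J'; auto.
    - exists J; intros; contradiction. }
  set (G := fix G n := match n with O => F (fun _ => True, O) | S m => F (G m, S m) end).
  assert (hG : forall n, infinite (G n) /\
     forall i j, G n i -> G n j -> nsq (vsub H (y i) (y j)) <= / INR (S n)).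
  { induction n as [|n IH].
    - destruct (hF (fun _ => True, O)) as [h1 [_ h2]].
      + intros N; exists N; simpl; auto.
      + split; auto.
    - destruct (hF (G n, S n)) as [h1 [_ h2]]; [apply IH|]. split; auto. }
  assert (hGm : forall m n, (m <= n)%nat -> forall i, G n i -> G m i).
  { intros m n hmn; induction hmn as [|n hmn IH]; auto.
    intros i hi; apply IH. apply (hF (G n, S n)); [apply hG|auto]. }
  destruct (choice (fun (q : nat * nat) k => (fst q < k)%nat /\ G (snd q) k)) as [f hf].
  { intros [m n]. destruct (proj1 (hG n) (S m)) as [k [h1 h2]]. exists k; split; auto. }
  set (phi := fix phi n := match n with O => f (O, O) | S m => f (phi m, S m) end).
  exists phi. assert (hphi : forall n, G n (phi n)).
  { intros [|n]; [exact (proj2 (hf (O, O))) | exact (proj2 (hf (phi n, S n)))]. }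
  split.
  - intros n. exact (proj1 (hf (phi n, S n))).
  - apply cauchy_cvg; intros eps he.
    destruct (archimed_cor1 eps he) as [N [hN hN0]].
    exists N; intros m n hm hn.
    eapply Rle_lt_trans; [apply (proj2 (hG N))|].
    + apply (hGm N m); auto.
    + apply (hGm N n); auto.
    + apply Rle_lt_trans with (/ INR N); auto.
      apply Rinv_le_contravar; [apply lt_0_INR; lia|]. apply le_INR; lia.
Qed.

Definition seq_compact T : Prop := forall (u : nat -> H) B, (forall n, nsq (u n) <= B) ->
  exists phi : nat -> nat, (forall n, (phi n < phi (S n))%nat) /\
    exists x, cvg (fun n => T (u (phi n))) x.

Lemma compact_seq_compact T : compact H T <-> seq_compact T.
Proof.
  split.
  - intros h u B hB. destruct (h u) as [phi [h1 h2]].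
    + exists (B + 1); intros n. specialize (hB n). rewrite <- norm_sqr in hB.
      assert (h0 := norm_ge0 (u n)); nra.
    + exists phi; split; auto. apply cvg_converges; auto.
  - intros h u [M hM]. destruct (h u (M * M)) as [phi [h1 h2]].
    + intros n. specialize (hM n). rewrite <- norm_sqr.
      assert (h0 := norm_ge0 (u n)); nra.
    + exists phi; split; auto. apply cvg_converges; auto.
Qed.

(** Where the images under [T] are Cauchy, so are those under [A]. Compactness passes in this way
    from [T] to [S T], with [S] the adjoint, and to the absolute value of [T]. *)
Lemma seq_compact_dominated A T K : linear A -> linear T -> 0 < K ->
  (forall x, nsq (A x) <= K * nsq (T x)) -> seq_compact T -> seq_compact A.
Proof.
  intros hA hT hK hle h u B hB. destruct (h u B hB) as [phi [h1 [x hx]]].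
  exists phi; split; auto. apply cauchy_cvg.
  intros eps he. destruct (cvg_cauchy _ _ hx (eps / K)) as [N hN].
  { apply Rdiv_lt_0_compat; auto. }
  exists N; intros m n hm hn. rewrite <- linear_sub by auto.
  eapply Rle_lt_trans; [apply hle|]. rewrite linear_sub by auto.
  specialize (hN m n hm hn). apply (Rmult_lt_compat_l K) in hN; auto.
  replace (K * (eps / K)) with eps in hN by (field; lra). auto.
Qed.

(** Outside [l] the coordinates obey [|<T x, e_k>|^2 = |<x, S e_k>|^2 <= |x|^2 |S e_k|^2], and [l]
    is chosen so that the remaining [|S e_k|^2] sum to at most [eps]. *)
Lemma hilbert_schmidt_tail T S (e : nat -> H) B : adjoint H T S -> orthoz e -> total e ->
  (forall l, NoDup l -> fsum (fun k => nsq (S (e k))) l <= B) ->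
  forall eps, 0 < eps -> exists l, NoDup l /\
    forall x, nsq (T x) <= fsum (fun k => Cmod2 (inner (T x) (e k))) l + eps * nsq x.
Proof.
  intros hS he ht hB eps heps.
  destruct (tsum_of_bound _ _ hB) as [s [hs _]].
  destruct (tsum_approx _ s (s - eps) hs) as [l [hl hl2]]; [lra|].
  exists l; split; auto. intros x.
  apply (parseval_tsum e (T x) he ht); intros y [l' [hl' ->]].
  set (m := filter (fun k => if excluded_middle_informative (In k l) then false else true) l').
  assert (hm : forall k, In k m <-> In k l' /\ ~ In k l).
  { intros k; unfold m; rewrite filter_In.
    destruct (excluded_middle_informative (In k l)); intuition congruence. }
  assert (hmn : NoDup m) by (apply NoDup_filter; auto).
  assert (h1 : fsum (fun k => Cmod2 (inner (T x) (e k))) l' <=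
               fsum (fun k => Cmod2 (inner (T x) (e k))) (l ++ m)).
  { apply fsum_incl; auto; [intros; apply Cmod2_ge0|].
    intros k hk; apply in_or_app. destruct (classic (In k l)); auto.
    right; apply hm; auto. }
  assert (h2 : fsum (fun k => nsq (S (e k))) (l ++ m) <= s).
  { apply (tsum_le _ _ _ hs). apply NoDup_app; auto.
    intros k hk hk2; apply hm in hk2; tauto. }
  rewrite fsum_app in h1, h2.
  assert (h3 : fsum (fun k => Cmod2 (inner (T x) (e k))) m <=
               nsq x * fsum (fun k => nsq (S (e k))) m).
  { rewrite <- fsum_scal. apply fsum_le; intros k _. rewrite hS. apply cauchy_schwarz. }
  assert (h4 := nsq_ge0 x). nra.
Qed.

Lemma hilbert_schmidt_compact T S K (e : nat -> H) B : linear T -> nsq_bounded T K ->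
  adjoint H T S -> orthoz e -> total e ->
  (forall l, NoDup l -> fsum (fun k => nsq (S (e k))) l <= B) -> seq_compact T.
Proof.
  intros hT [hK hb] hS he ht hB u M hM.
  assert (hM0 : 0 <= M) by (specialize (hM 0%nat); assert (h := nsq_ge0 (u 0%nat)); lra).
  apply (totally_bounded_subsequence (fun n => T (u n))).
  intros eps heps J hJ.
  (* Differences satisfy [|u_i - u_j|^2 <= 4 M], so this tolerance costs at most [eps / 2]; the
     [+ 1] covers [M = 0]. *)
  destruct (hilbert_schmidt_tail T S e B hS he ht hB (eps / (8 * (M + 1)))) as [l [hl hl2]].
  { apply Rdiv_lt_0_compat; lra. }
  destruct (infinite_refine_coords e (fun n => T (u n)) (K * M) (eps / 2) l) with (J := J)
    as [J' [h1 [h2 h3]]]; auto.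
  - intros; apply orthoz_nsq_le1; auto.
  - intros n; eapply Rle_trans; [apply hb|]. apply Rmult_le_compat_l; auto; lra.
  - lra.
  - exists J'; split; [auto|split; auto]. intros i j hi hj.
    assert (a1 := hl2 (vsub H (u i) (u j))). rewrite linear_sub in a1 by auto.
    assert (a2 := h3 i j hi hj). simpl in a2.
    assert (a3 : nsq (vsub H (u i) (u j)) <= 4 * M).
    { assert (h := nsq_sub_triangle (u i) vzero (u j)).
      rewrite (nsq_sub_sym vzero) in h.
      assert (e0 : forall y, vsub H y vzero = y) by (intros; veq).
      rewrite !e0 in h. assert (b1 := hM i); assert (b2 := hM j); lra. }
    assert (a4 : eps / (8 * (M + 1)) * nsq (vsub H (u i) (u j)) <= eps / 2).
    { apply Rle_trans with (eps / (8 * (M + 1)) * (4 * (M + 1))).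
      - apply Rmult_le_compat_l; [|lra]. apply Rlt_le, Rdiv_lt_0_compat; lra.
      - apply Req_le; field; lra. }
    lra.
Qed.

Lemma lower_bounded_finite {I J : Type} (f : I -> H) (c eps : R) (x : J -> H) (K : list J) :
  lower_bounded f c -> 0 < eps -> exists L, NoDup L /\ forall k, In k K ->
    c * nsq (x k) - eps <= fsum (fun i => Cmod2 (inner (x k) (f i))) L.
Proof.
  intros hf he; induction K as [|k K [L [hL hL2]]].
  - exists nil; split; [constructor|now intros].
  - destruct (hf (x k) (c * nsq (x k) - eps)) as [l [hl hl2]]; [lra|].
    exists (cnodup (l ++ L)); split; [apply cnodup_NoDup|].
    intros k' [<-|hk].
    + eapply Rle_trans; [apply hl2|]. apply fsum_incl; auto; [intros; apply Cmod2_ge0|].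
      intros i hi; apply cnodup_In, in_or_app; auto.
    + eapply Rle_trans; [apply hL2; auto|]. apply fsum_incl; auto; [intros; apply Cmod2_ge0|].
      intros i hi; apply cnodup_In, in_or_app; auto.
Qed.

(** The lower frame inequalities for the [x k] are added with weights [b k] and the two finite sums
    swapped. It is used with [x k = S (e k)] and weight 1, and with the singular vectors and weights
    [lam_k^p]. *)
Lemma weighted_lower_bound {I J : Type} (f : I -> H) (c w : R) (x : J -> H) (b : J -> R)
  (K : list J) : lower_bounded f c -> (forall k, 0 <= b k) ->
  (forall L, NoDup L ->
     fsum (fun i => fsum (fun k => b k * Cmod2 (inner (x k) (f i))) K) L <= w) ->
  c * fsum (fun k => b k * nsq (x k)) K <= w.
Proof.
  intros hf hb hw. apply le_epsilon; intros eps he.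
  assert (hB : 0 <= fsum b K) by (apply fsum_ge0; auto).
  destruct (lower_bounded_finite f c (eps / (fsum b K + 1)) x K hf) as [L [hL hL2]].
  { apply Rdiv_lt_0_compat; lra. }
  apply Rle_trans with (fsum (fun k => b k * fsum (fun i => Cmod2 (inner (x k) (f i))) L
                                       + eps / (fsum b K + 1) * b k) K).
  - rewrite <- fsum_scal. apply fsum_le; intros k hk.
    specialize (hL2 k hk). specialize (hb k). nra.
  - rewrite fsum_add, fsum_scal. apply Rplus_le_compat.
    + eapply Rle_trans; [|apply (hw L hL)]. rewrite fsum_swap.
      apply fsum_le; intros k _. rewrite fsum_scal; lra.
    + apply Rle_trans with (eps / (fsum b K + 1) * (fsum b K + 1)).
      * apply Rmult_le_compat_l; [|lra]. apply Rlt_le, Rdiv_lt_0_compat; lra.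
      * apply Req_le; field; lra.
Qed.

(** By Bessel [sum_k |<T f_i, e_k>|^2 <= |T f_i|^2]. Read as [|<f_i, S e_k>|^2] and summed over [i],
    the left side dominates [c sum_k |S e_k|^2]. *)
Lemma frame_hilbert_schmidt {I : Type} T S K (f : I -> H) (c w : R) : linear T ->
  nsq_bounded T K -> adjoint H T S -> lower_bounded f c -> 0 < c ->
  (forall l, NoDup l -> fsum (fun i => nsq (T (f i))) l <= w) -> seq_compact T.
Proof.
  intros hT hK hS hf hc hw. destruct (@orthoz_total_exists H) as [e [he ht]].
  apply (hilbert_schmidt_compact T S K e (w / c)); auto. intros l hl.
  assert (h : c * fsum (fun k => 1 * nsq (S (e k))) l <= w).
  { apply (weighted_lower_bound f c w (fun k => S (e k))); auto; [intros; lra|].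
    intros L hL. eapply Rle_trans; [|apply (hw L hL)]. apply fsum_le; intros i _.
    eapply Rle_trans; [|apply (bessel e l (T (f i)) he hl)].
    apply fsum_le; intros k _. rewrite hS, (inner_conj _ (S (e k))), Cmod2_conj; lra. }
  rewrite fsum_scal in h. apply (Rmult_le_reg_l c); auto.
  replace (c * (w / c)) with w by (field; lra). lra.
Qed.

End Compactness.

(** * Spectral theorem for positive compact operators *)

Section Spectral.
Context {H : HilbertSpace}.
Implicit Types x y z : H.

(** Cauchy-Schwarz for a form that is positive on [W] only. The discriminant argument involves real
    combinations alone, hence the closure condition on [W]. *)
Lemma positive_form_cs (B : H -> H) (W : H -> Prop) x y : linear B -> adjoint H B B ->
  (forall a b t, W a -> W b -> W (vadd a (vscal (RtoC t) b))) ->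
  (forall a, W a -> 0 <= Re (inner (B a) a)) -> W x -> W y ->
  Re (inner (B x) y) * Re (inner (B x) y) <= Re (inner (B x) x) * Re (inner (B y) y).
Proof.
  intros hB hs hW hp hx hy. apply discriminant_le; auto. intros t.
  assert (h := hp _ (hW x y t hx hy)).
  rewrite (proj1 hB), (proj2 hB) in h. revert h; inn; simpl.
  rewrite (hs y x), (Re_inner_sym (B x) y). intros h. nra.
Qed.

(** Cauchy-Schwarz for the form of [A] at [y] and [A y] gives [|A y|^4 <= 0]. *)
Lemma positive_form_eq0 (A : H -> H) y : linear A -> adjoint H A A ->
  (forall x, 0 <= Re (inner (A x) x)) -> Re (inner (A y) y) <= 0 -> A y = vzero.
Proof.
  intros hA hs hp h. apply nsq_eq0.
  assert (h1 := positive_form_cs A (fun _ => True) y (A y) hA hs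
                  (fun _ _ _ _ _ => Logic.I) (fun a _ => hp a) Logic.I Logic.I).
  assert (h2 := hp y). assert (h3 := nsq_ge0 (A y)). fold (nsq (A y)) in h1.
  replace (Re (inner (A y) y)) with 0 in h1 by lra. nra.
Qed.

Definition perp (U : H -> Prop) (x : H) : Prop := forall u, U u -> inner x u = C0.

Lemma perp_add U x y a : perp U x -> perp U y -> perp U (vadd x (vscal a y)).
Proof. intros hx hy u hu; inn. rewrite hx, hy by auto. apply C_ext; simpl; ring. Qed.

Lemma perp_scal U a x : perp U x -> perp U (vscal a x).
Proof. intros hx u hu; inn. rewrite hx by auto. apply C_ext; simpl; ring. Qed.

Lemma perp_cvg U (v : nat -> H) x : (forall n, perp U (v n)) -> cvg v x -> perp U x.
Proof.
  intros h hv u hu. apply (cvg_inner_eventually _ _ _ _ 0 hv); intros n _; apply h; auto.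
Qed.

(* A maximizing sequence of the quadratic form of [A] on [perp U] becomes an
   approximate eigenvector because [m - A] is a positive form there. *)
Lemma top_eigenvector (A : H -> H) K (U : H -> Prop) : linear A -> nsq_bounded A K ->
  adjoint H A A -> (forall x, 0 <= Re (inner (A x) x)) -> seq_compact A ->
  (forall x, perp U x -> perp U (A x)) ->
  exists x mu, perp U x /\ A x = vscal (RtoC mu) x /\
    (x = vzero /\ mu = 0 \/ inner x x = C1 /\ 0 < mu) /\
    forall y, perp U y -> Re (inner (A y) y) <= mu * nsq y.
Proof.
  intros hA hK hs hp hc hinv.
  (* The supremum runs over the unit ball, not the sphere, since [perp U] may contain only zero;
     then [m = 0]. *)
  destruct (completeness (fun r => exists x, (perp U x /\ nsq x <= 1) /\
                                     r = Re (inner (A x) x))) as [m [hub hlub]].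
  { exists (K + 1); intros r [x [[_ hx] ->]].
    assert (h := Re_inner_le (A x) x). destruct hK as [hK0 hK].
    assert (h1 := hK x); assert (h2 := nsq_ge0 x); assert (h3 := nsq_ge0 (A x)).
    assert (h4 := hp x). set (r := Re (inner (A x) x)) in *.
    assert (r * r <= K * 1) by nra. nra. }
  { eexists; exists vzero; split; [split|reflexivity].
    - intros u _; apply inner_0l.
    - rewrite nsq_0; lra. }
  assert (hm : forall y, perp U y -> Re (inner (A y) y) <= m * nsq y).
  { intros y hy. destruct (Req_dec (nsq y) 0) as [h0|h0].
    { rewrite (nsq_eq0 y h0), inner_0r, nsq_0; simpl; lra. }
    assert (h1 : 0 < nsq y) by (assert (h := nsq_ge0 y); lra).
    set (t := / sqrt (nsq y)).
    assert (ht : t * t = / nsq y).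
    { unfold t. rewrite <- Rinv_mult, sqrt_sqrt by lra. reflexivity. }
    assert (h2 : Re (inner (A (vscal (RtoC t) y)) (vscal (RtoC t) y)) <= m).
    { apply hub; exists (vscal (RtoC t) y); split; [split|reflexivity].
      - apply perp_scal; auto.
      - rewrite nsq_scal; unfold Cmod2; simpl. rewrite ht, Rmult_0_l, Rplus_0_r.
        rewrite Rinv_l by lra; lra. }
    rewrite (proj2 hA) in h2. revert h2; inn; simpl; intros h2.
    assert (h3 : t * t * Re (inner (A y) y) <= m) by lra.
    rewrite ht in h3. apply (Rmult_le_compat_l (nsq y)) in h3; [|lra].
    rewrite <- Rmult_assoc, Rinv_r, Rmult_1_l in h3 by lra. lra. }
  assert (hm0 : 0 <= m).
  { apply hub; exists vzero; split; [split|].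
    - intros u _; apply inner_0l.
    - rewrite nsq_0; lra.
    - rewrite inner_0r; reflexivity. }
  destruct (Rle_lt_or_eq_dec 0 m hm0) as [hpos|<-].
  2: { exists vzero, 0; split; [intros u _; apply inner_0l|].
       split; [rewrite linear_0, vscal_0r by auto; reflexivity|]. auto. }
  assert (hx : forall n : nat, exists x, (perp U x /\ nsq x <= 1) /\
                 m - / (INR n + 1) < Re (inner (A x) x)).
  { intros n. apply NNPP; intros hn.
    assert (hi : 0 < / (INR n + 1))
      by (apply Rinv_0_lt_compat; assert (h := pos_INR n); lra).
    enough (m <= m - / (INR n + 1)) by lra. apply hlub; intros r [x [hx ->]].
    destruct (Rlt_le_dec (m - / (INR n + 1)) (Re (inner (A x) x))) as [h|h]; auto.
    exfalso; apply hn; eauto. }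
  apply choice in hx; destruct hx as [v hv].
  set (B := fun x => vsub H (vscal (RtoC m) x) (A x)).
  assert (hB : linear B).
  { split; intros; unfold B; [rewrite (proj1 hA) | rewrite (proj2 hA)]; veq. }
  assert (hBs : adjoint H B B).
  { intros x y; unfold B; inn. rewrite hs. apply C_ext; simpl; ring. }
  assert (hBq : forall x, Re (inner (B x) x) = m * nsq x - Re (inner (A x) x)).
  { intros x; unfold B, nsq; inn; simpl; ring. }
  assert (hBW : forall x, perp U x -> perp U (B x)).
  { intros x hx; unfold B.
    replace (vsub H (vscal (RtoC m) x) (A x))
      with (vadd (vscal (RtoC m) x) (vscal (RtoC (-1)) (A x))) by veq.
    apply perp_add; auto. apply perp_scal; auto. }
  (* Cauchy-Schwarz at [x] and [B x], with [<B B x, B x> <= m |B x|^2] because the form of [A] is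
     nonnegative. *)
  assert (hBn : forall x, perp U x -> nsq (B x) <= m * Re (inner (B x) x)).
  { intros x hx.
    assert (h := positive_form_cs B (perp U) x (B x) hB hBs
      (fun a b t ha hb => perp_add U a b (RtoC t) ha hb)).
    assert (hq : forall a, perp U a -> 0 <= Re (inner (B a) a)).
    { intros a ha; rewrite hBq; assert (h1 := hm a ha); lra. }
    specialize (h hq hx (hBW x hx)). fold (nsq (B x)) in h.
    assert (h1 := hBq (B x)); assert (h2 := hp (B x)); assert (h3 := hq x hx).
    assert (h4 := nsq_ge0 (B x)).
    destruct (Req_dec (nsq (B x)) 0) as [h5|h5];
      [rewrite h5; apply Rmult_le_pos; auto|].
    apply (Rmult_le_reg_l (nsq (B x))); [lra|].
    eapply Rle_trans; [apply h|].
    apply Rle_trans with (Re (inner (B x) x) * (m * nsq (B x))).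
    - apply Rmult_le_compat_l; auto; lra.
    - apply Req_le; ring. }
  assert (hBv : forall n, nsq (B (v n)) <= m * / (INR n + 1)).
  { intros n. destruct (hv n) as [[h1 h2] h3].
    eapply Rle_trans; [apply hBn; auto|]. apply Rmult_le_compat_l; auto.
    rewrite hBq. assert (h4 := nsq_ge0 (v n)). nra. }
  destruct (hc v 1) as [phi [hphi [y hy]]]; [intros n; apply (hv n)|].
  assert (hge := strict_mono_ge phi hphi).
  assert (hile : forall n, / (INR (phi n) + 1) <= / (INR n + 1)).
  { intros n. apply Rinv_le_contravar.
    - assert (h := pos_INR n); lra.
    - specialize (hge n); apply le_INR in hge; lra. }
  set (x := vscal (RtoC (/ m)) y).
  (* [m v = B v + A v], where [B v] tends to 0 and [A v] to [y] along [phi]; hence [v] tends to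
     [y / m]. *)
  assert (hvx : cvg (fun n => v (phi n)) x).
  { intros eps he.
    assert (hp1 : 0 < m * eps) by (apply Rmult_lt_0_compat; auto).
    assert (hp2 : 0 < m * m * eps) by (rewrite Rmult_assoc; apply Rmult_lt_0_compat; auto).
    destruct (hy (m * m * eps / 4)) as [N1 hN1]; [lra|].
    destruct (inv_succ_small (m * eps / 4)) as [N2 hN2]; [lra|].
    exists (Nat.max N1 N2); intros n hn.
    specialize (hN1 n ltac:(lia)); specialize (hN2 n ltac:(lia)).
    assert (h1 := hBv (phi n)). assert (h2 := hile n).
    assert (h3 : nsq (B (v (phi n))) < m * m * eps / 4).
    { eapply Rle_lt_trans; [apply h1|].
      replace (m * m * eps / 4) with (m * (m * eps / 4)) by field.
      apply Rmult_lt_compat_l; auto; lra. }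
    assert (e : vsub H (v (phi n)) x = vscal (RtoC (/ m))
       (vsub H (B (v (phi n))) (vsub H y (A (v (phi n)))))).
    { unfold B, x; apply inner_ext; intro; inn; apply C_ext; simpl; field; lra. }
    rewrite e, nsq_scal; unfold Cmod2; simpl.
    assert (h4 := nsq_sub_triangle (B (v (phi n))) vzero (vsub H y (A (v (phi n))))).
    rewrite (nsq_sub_sym vzero) in h4.
    assert (e0 : forall a, vsub H a vzero = a) by (intros; veq).
    rewrite !e0, (nsq_sub_sym y) in h4.
    set (q := nsq (vsub H (B (v (phi n))) (vsub H y (A (v (phi n)))))) in *.
    assert (h5 : q < m * m * eps) by lra.
    replace eps with (/ m * / m * (m * m * eps)) by (field; lra).
    replace ((/ m * / m + 0 * 0) * q) with (/ m * / m * q) by ring.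
    apply Rmult_lt_compat_l; auto.
    apply Rmult_lt_0_compat; apply Rinv_0_lt_compat; auto. }
  assert (hAx : A x = vscal (RtoC m) x).
  { apply (cvg_unique (fun n => A (v (phi n)))).
    - apply (cvg_bounded A K); auto.
    - replace (vscal (RtoC m) x) with y; auto.
      unfold x; apply inner_ext; intro; inn; apply C_ext; simpl; field; lra. }
  exists x, m; split; [|split; [auto|split; [|auto]]].
  - apply (perp_cvg U (fun n => v (phi n))); auto. intros n; apply (hv (phi n)).
  - right; split; auto. rewrite inner_self. apply C_ext; simpl; auto.
    apply Rle_antisym.
    + apply (@Rle_cv_lim (fun n => nsq (v (phi n))) (fun _ => 1)).
      * intros n; apply (hv (phi n)).
      * apply cvg_nsq; auto.
      * apply Un_cv_const.
    (* The maximizing sequence satisfies [m - 1 / (n + 1) < <A v, v> <= m |v|^2], so no norm is lost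
       in the limit. *)
    + apply (Rmult_le_reg_l m); auto. rewrite Rmult_1_r.
      apply (@Rle_cv_lim (fun n => m - / (INR n + 1)) (fun n => m * nsq (v (phi n)))).
      * intros n. destruct (hv (phi n)) as [[h1 h2] h3].
        assert (h4 := hm _ h1). assert (h5 := hile n). lra.
      * apply Un_cv_intro; intros eps he; destruct (inv_succ_small eps he) as [N hN].
        exists N; intros n hn; specialize (hN n hn).
        assert (h : 0 < / (INR n + 1)) by (apply Rinv_0_lt_compat; assert (h := pos_INR n); lra).
        apply Rabs_def1; lra.
      * apply CV_mult; [apply Un_cv_const|]. apply cvg_nsq; auto.
Qed.

Lemma eigen_perp_invariant (A : H -> H) (U : H -> Prop) : adjoint H A A ->
  (forall u, U u -> exists mu, A u = vscal (RtoC mu) u) ->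
  forall x, perp U x -> perp U (A x).
Proof.
  intros hs hU x hx u hu. destruct (hU u hu) as [mu h].
  rewrite hs, h, inner_scalr, hx by auto. apply C_ext; simpl; ring.
Qed.

(** Deflation: each [u n] is a top eigenvector on the complement of the earlier ones, or zero once
    the form vanishes there. On vectors orthogonal to all [u n] the form is at most [mu n |y|^2] for
    every [n], hence zero. *)
Lemma spectral_sequence (A : H -> H) K : linear A -> nsq_bounded A K ->
  adjoint H A A -> (forall x, 0 <= Re (inner (A x) x)) -> seq_compact A ->
  exists (u : nat -> H) (mu : nat -> R), orthoz u /\
    (forall n, u n = vzero /\ mu n = 0 \/ inner (u n) (u n) = C1 /\ 0 < mu n) /\
    (forall n, A (u n) = vscal (RtoC (mu n)) (u n)) /\
    (forall n, mu (S n) <= mu n) /\ Un_cv mu 0 /\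
    forall y, (forall n, inner y (u n) = C0) -> A y = vzero.
Proof.
  intros hA hK hs hp hc.
  set (good := fun (L : list H) (q : H * R) => let (x, mu) := q in
    perp (fun v => In v L) x /\ A x = vscal (RtoC mu) x /\
    (x = vzero /\ mu = 0 \/ inner x x = C1 /\ 0 < mu) /\
    forall y, perp (fun v => In v L) y -> Re (inner (A y) y) <= mu * nsq y).
  set (eigs := fun L : list H => forall v, In v L -> exists mu, A v = vscal (RtoC mu) v).
  destruct (choice (fun L q => eigs L -> good L q)) as [F hF].
  { intros L. destruct (classic (eigs L)) as [hL|hL].
    - destruct (top_eigenvector A K (fun v => In v L)) as [x [mu h]]; auto.
      + apply eigen_perp_invariant; auto.
      + exists (x, mu); intros _; exact h.
    - exists (vzero, 0); intros h; contradiction. }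
  set (G := fix G n := match n with O => nil | S m => fst (F (G m)) :: G m end).
  set (u := fun n => fst (F (G n))). set (mu := fun n => snd (F (G n))).
  assert (hG : forall n, eigs (G n)).
  { induction n as [|n IH]; intros v; simpl; [contradiction|].
    intros [<-|hv]; [|apply IH; auto].
    assert (h := hF _ IH). destruct (F (G n)) as [x t]; exists t; apply h. }
  assert (hgood : forall n, good (G n) (u n, mu n)).
  { intros n. assert (h := hF _ (hG n)). unfold u, mu.
    rewrite <- surjective_pairing; auto. }
  assert (hin : forall m n, (m < n)%nat -> In (u m) (G n)).
  { intros m n h; induction h; simpl; auto. }
  assert (hin2 : forall n x, In x (G n) -> exists m, x = u m).
  { induction n as [|n IH]; simpl; intros x hx; [contradiction|].
    destruct hx as [<-|hx]; [exists n; reflexivity | auto]. }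
  assert (horth : forall m n, (m < n)%nat -> inner (u n) (u m) = C0).
  { intros m n h; apply (proj1 (hgood n)); auto. }
  assert (h01 : forall n, u n = vzero /\ mu n = 0 \/ inner (u n) (u n) = C1 /\ 0 < mu n).
  { intros n; apply (hgood n). }
  assert (hmu0 : forall n, 0 <= mu n).
  { intros n; destruct (h01 n) as [[_ h]|[_ h]]; lra. }
  assert (heig : forall n, A (u n) = vscal (RtoC (mu n)) (u n)).
  { intros n; apply (hgood n). }
  assert (hu : orthoz u).
  { split.
    - intros n; destruct (h01 n) as [[h _]|[h _]]; auto.
    - intros i j hij. destruct (Nat.lt_trichotomy i j) as [h|[->|h]].
      + apply inner_eq0_sym; auto.
      + congruence.
      + auto. }
  assert (hdec : forall n, mu (S n) <= mu n).
  { intros n. destruct (h01 (S n)) as [[_ ->]|[h1 h2]]; auto.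
    destruct (hgood n) as [_ [_ [_ hmax]]]. specialize (hmax (u (S n))).
    rewrite heig, inner_scall in hmax. unfold nsq in hmax; rewrite h1 in hmax; simpl in hmax.
    enough (mu (S n) * 1 - 0 * 0 <= mu n * 1) by lra. apply hmax.
    intros v hv; apply (proj1 (hgood (S n))). simpl; auto. }
  assert (hlim : Un_cv mu 0).
  { assert (hle : forall m n, (m <= n)%nat -> mu n <= mu m).
    { intros m n h; induction h as [|n h IH]; [lra|]. specialize (hdec n); lra. }
    intros eps he. apply NNPP; intros hn.
    assert (hbig : forall n, eps <= mu n).
    { intros n. destruct (Rle_lt_dec eps (mu n)) as [h|h]; auto.
      exfalso; apply hn; exists n; intros k hk; unfold Rdist.
      rewrite Rminus_0_r, Rabs_pos_eq by auto. assert (h2 := hle n k ltac:(lia)); lra. }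
    (* If [mu] stayed above [eps], the images [A (u n)] would have mutual squared distances at least
       [2 eps^2], against compactness. *)
    destruct (hc u 1) as [phi [hphi [y hy]]].
    { intros n; apply orthoz_nsq_le1; auto. }
    destruct (cvg_cauchy _ _ hy (eps * eps)) as [N hN]; [nra|].
    specialize (hN N (S N) ltac:(lia) ltac:(lia)).
    rewrite !heig, nsq_sub, !nsq_scal, inner_scall, inner_scalr in hN.
    rewrite (proj2 hu (phi N) (phi (S N))) in hN by (specialize (hphi N); lia).
    assert (h1 : forall n, nsq (u n) = 1).
    { intros n; destruct (h01 n) as [[_ h]|[h _]].
      - specialize (hbig n); lra.
      - unfold nsq; rewrite h; reflexivity. }
    rewrite !h1 in hN. unfold Cmod2 in hN; simpl in hN.
    assert (h2 := hbig (phi N)); assert (h3 := hbig (phi (S N))). nra. }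
  exists u, mu; repeat (split; [assumption|]).
  intros y hy. apply positive_form_eq0; auto.
  apply (@Rle_cv_lim (fun _ => Re (inner (A y) y)) (fun n => mu n * nsq y)).
  - intros n. apply (hgood n). intros v hv. destruct (hin2 n v hv) as [m ->]; auto.
  - apply Un_cv_const.
  - rewrite <- (Rmult_0_l (nsq y)). apply CV_mult; auto. apply Un_cv_const.
Qed.

End Spectral.

(** * Absolute value and singular values *)

Lemma upward_closed_threshold (Q : nat -> Prop) (N : nat) :
  (forall n, Q n -> Q (S n)) -> Q N -> exists a, forall n, Q n <-> (a <= n)%nat.
Proof.
  intros hQ hN.
  assert (hup : forall m n, (m <= n)%nat -> Q m -> Q n).
  { intros m n h; induction h; auto. }
  induction N as [|N IH].
  - exists 0%nat; intros n; split; [lia|]. intros _; apply (hup 0%nat); auto; lia.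
  - destruct (classic (Q N)) as [h|h]; auto.
    exists (S N); intros n; split; intros hn.
    + destruct (Nat.lt_ge_cases N n) as [|hle]; auto. exfalso; apply h, (hup n); auto.
    + apply (hup (S N)); auto.
Qed.

Section SingularValues.
Context {H : HilbertSpace}.
Implicit Types x y z : H.
Implicit Types T S P : H -> H.

(** Polarization: [<P z, z>] is real for [z = x], [y], [x + y] and [x + i y]. *)
Lemma positive_adjoint P : positive_op H P -> adjoint H P P.
Proof.
  intros [[h1 [h2 _]] hp] x y.
  assert (a1 := proj1 (hp x)); assert (a2 := proj1 (hp y)).
  assert (a3 := proj1 (hp (vadd x y))).
  assert (a4 := proj1 (hp (vadd x (vscal (mkC 0 1) y)))).
  rewrite h1 in a3, a4. rewrite h2 in a4. revert a1 a2 a3 a4; inn; simpl; intros.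
  rewrite (inner_conj _ (P y) x). apply C_ext; simpl; lra.
Qed.

Lemma abs_op_nsq T P x : abs_op H T P -> nsq (P x) = nsq (T x).
Proof.
  intros [hP [S [hS hPP]]]. unfold nsq. rewrite (positive_adjoint P hP), hPP, <- hS.
  reflexivity.
Qed.

Lemma eigenvalues_orth P a b x y : adjoint H P P ->
  P x = vscal (RtoC a) x -> P y = vscal (RtoC b) y -> a <> b -> inner x y = C0.
Proof.
  intros hP hx hy hab. assert (h := hP x y). rewrite hx, hy, inner_scall, inner_scalr in h.
  assert (h1 := f_equal Re h); assert (h2 := f_equal Im h); simpl in *.
  apply C_ext; simpl; apply (Rmult_eq_reg_l (a - b)); lra.
Qed.

(** The difference is orthogonal to every [u k], so the second hypothesis applies to it and makes it
    orthogonal to itself. Operators defined through [u] can thus be compared although [u] need not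
    be total. *)
Lemma orth_decomposition_eq (u : nat -> H) y y' :
  (forall k, inner y (u k) = inner y' (u k)) ->
  (forall z, (forall k, inner z (u k) = C0) -> inner y z = inner y' z) -> y = y'.
Proof.
  intros e1 e2. apply vsub_eq0, vec_eq0_of_inner_self.
  assert (e3 : forall k, inner (vsub H y y') (u k) = C0).
  { intros k; inn; rewrite e1; apply C_ext; simpl; ring. }
  assert (e4 := e2 _ e3). set (w := vsub H y y') in *. unfold w at 1, vsub.
  rewrite inner_addl, inner_oppl, e4. apply C_ext; simpl; ring.
Qed.

(* [P x] is defined as the limit of [sum_(k < N) lam_k <x, u_k> u_k]. *)
Lemma diagonal_operator (u : nat -> H) (lam : nat -> R) M : orthoz u ->
  (forall n, 0 <= lam n <= M) ->
  exists P, positive_op H P /\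
    (forall x k, inner (P x) (u k) = Cmul (RtoC (lam k)) (inner x (u k))) /\
    (forall x z, (forall k, inner z (u k) = C0) -> inner (P x) z = C0).
Proof.
  intros hu hlam.
  set (c := fun x k => Cmul (RtoC (lam k)) (inner x (u k))).
  assert (hc : forall x N, fsum (fun k => Cmod2 (c x k)) (seq 0 N) <= M * M * nsq x).
  { intros x N.
    apply Rle_trans with (fsum (fun k => M * M * Cmod2 (inner x (u k))) (seq 0 N)).
    - apply fsum_le; intros k _. unfold c; rewrite Cmod2_mul.
      apply Rmult_le_compat_r; [apply Cmod2_ge0|]. unfold Cmod2; simpl.
      specialize (hlam k); nra.
    - rewrite fsum_scal. apply Rmult_le_compat_l; [nra|]. apply bessel; auto using seq_NoDup. }
  destruct (choice (fun x y => cvg (fun N => lsum (c x) u (seq 0 N)) y)) as [P hP].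
  { intros x; apply (riesz_fischer u (c x) (M * M * nsq x)); auto. }
  assert (h1 : forall x k, inner (P x) (u k) = Cmul (RtoC (lam k)) (inner x (u k))).
  { intros x k. rewrite (cvg_lsum_inner u (c x) (P x) k hu (hP x)). unfold c.
    rewrite <- (orthoz_inner_self u x k hu) at 2. apply C_ext; simpl; ring. }
  assert (h2 : forall x z, (forall k, inner z (u k) = C0) -> inner (P x) z = C0).
  { intros x z hz. apply (cvg_lsum_orth u (c x)); auto. }
  exists P; split; [split; [|]|split; auto].
  - apply (nsq_bounded_linear P (M * M + 1)); split.
    + intros x y; apply (orth_decomposition_eq u).
      * intros k; rewrite h1; inn; rewrite !h1. apply C_ext; simpl; ring.
      * intros z hz; inn; rewrite !h2 by auto. apply C_ext; simpl; ring.
    + intros a x; apply (orth_decomposition_eq u).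
      * intros k; rewrite h1; inn; rewrite !h1. apply C_ext; simpl; ring.
      * intros z hz; inn; rewrite !h2 by auto. apply C_ext; simpl; ring.
    + nra.
    + intros x. apply Rle_trans with (M * M * nsq x).
      * apply (@Rle_cv_lim (fun N => nsq (lsum (c x) u (seq 0 N))) (fun _ => M * M * nsq x)).
        -- intros N; rewrite nsq_lsum by auto using seq_NoDup.
           eapply Rle_trans; [|apply (hc x N)]. apply fsum_le; intros k _.
           assert (h3 := orthoz_nsq_le1 u k hu); assert (h4 := Cmod2_ge0 (c x k)); nra.
        -- apply cvg_nsq; auto.
        -- apply Un_cv_const.
      * assert (h := nsq_ge0 x); nra.
  - intros x.
    assert (hl : forall l, Im (inner (lsum (c x) u l) x) = 0 /\
                           0 <= Re (inner (lsum (c x) u l) x)).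
    { induction l as [|k l [IH1 IH2]].
      { change (lsum (c x) u nil) with (@vzero H); rewrite inner_0l; simpl; lra. }
      rewrite lsum_cons, inner_addl, inner_scall. unfold c at 1 3.
      rewrite (inner_conj _ x (u k)). simpl. rewrite IH1.
      destruct (hlam k) as [h3 _]. split; [ring|].
      assert (h4 := Rmult_le_pos _ _ h3 (Cmod2_ge0 (inner x (u k)))).
      unfold Cmod2 in h4. lra. }
    split.
    + apply (Un_cv_eventually_const _ _ _ 0 (cvg_Im_inner _ _ x (hP x))).
      intros n _; apply hl.
    + apply (@Rle_cv_lim (fun _ => 0) (fun N => Re (inner (lsum (c x) u (seq 0 N)) x))).
      * intros; apply hl.
      * apply Un_cv_const.
      * apply cvg_Re_inner; auto.
Qed.

(** An eigenvector for [mu > 0] is orthogonal to every [u k] with [lam k <> mu] and, by the last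
    hypothesis, to everything orthogonal to [u]. So it lies in the span of one block of [u], finite
    because [lam] tends to 0. *)
Lemma diagonal_sing_vals (u : nat -> H) (lam : nat -> R) P : orthoz u -> adjoint H P P ->
  (forall n, u n = vzero /\ lam n = 0 \/ inner (u n) (u n) = C1 /\ 0 < lam n) ->
  (forall n, lam (S n) <= lam n) -> Un_cv lam 0 ->
  (forall n, P (u n) = vscal (RtoC (lam n)) (u n)) ->
  (forall x z, (forall k, inner z (u k) = C0) -> inner (P x) z = C0) ->
  sing_vals H P lam.
Proof.
  intros hu hs h01 hdec hlim heig hz.
  assert (hl0 : forall n, 0 <= lam n)
    by (intros n; destruct (h01 n) as [[_ h]|[_ h]]; lra).
  assert (hcoef : forall mu x k, P x = vscal (RtoC mu) x -> lam k <> mu -> inner x (u k) = C0).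
  { intros mu x k hx hk. apply (eigenvalues_orth P mu (lam k)); auto. }
  assert (hself : forall mu x w, 0 < mu -> P x = vscal (RtoC mu) x ->
            (forall k, inner w (u k) = C0) -> inner x w = C0).
  { intros mu x w hmu hx hw. assert (h := hz x w hw). rewrite hx, inner_scall in h.
    assert (h1 := f_equal Re h); assert (h2 := f_equal Im h); simpl in *.
    apply C_ext; simpl; apply (Rmult_eq_reg_l mu); lra. }
  split; [auto|split; [auto|split]].
  - intros mu hmu; split.
    + intros [x [hx0 hx]]. apply NNPP; intros hn. apply hx0.
      apply vec_eq0_of_inner_self, (hself mu); auto.
      intros k; apply (hcoef mu); auto. intros e; apply hn; eauto.
    + intros [n <-]. exists (u n); split; auto.
      intros e. destruct (h01 n) as [[_ h]|[h _]]; [lra|].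
      rewrite e, inner_0l in h. assert (h1 := f_equal Re h); simpl in h1; lra.
  - intros mu hmu _.
    assert (hN : exists N, lam N < mu).
    { destruct (hlim mu hmu) as [N hN]. exists N. specialize (hN N (le_n N)).
      unfold Rdist in hN. apply Rabs_def2 in hN; lra. }
    destruct hN as [N hN].
    (* The block of [mu] starts where [lam n <= mu] begins to hold and ends where [lam n < mu]
       does. *)
    destruct (upward_closed_threshold (fun n => lam n <= mu) N) as [a ha]; [|lra|].
    { intros n hn; specialize (hdec n); lra. }
    destruct (upward_closed_threshold (fun n => lam n < mu) N) as [b hb]; [|lra|].
    { intros n hn; specialize (hdec n); lra. }
    assert (hr : forall n, lam n = mu <-> (a <= n < a + (b - a))%nat).
    { intros n; split.
      - intros e. assert (h1 : (a <= n)%nat) by (apply ha; lra).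
        assert (h2 : ~ (b <= n)%nat) by (intros h; apply hb in h; lra). lia.
      - intros h. assert (h1 : lam n <= mu) by (apply ha; lia).
        assert (h2 : ~ lam n < mu) by (intros h2; apply hb in h2; lia). lra. }
    exists a, (b - a)%nat; split; auto.
    set (v := fun i => u (a + i)%nat).
    assert (hv : orthoz v) by (apply (orthoz_reindex (fun i => (a + i)%nat) u); auto; lia).
    assert (hlv : forall i, (i < b - a)%nat -> lam (a + i)%nat = mu) by (intros; apply hr; lia).
    exists v; split; [|split].
    + intros i j hi hj. destruct (Nat.eqb_spec i j) as [<-|hij].
      * unfold v. destruct (h01 (a + i)%nat) as [[_ h]|[h _]]; auto.
        rewrite hlv in h by auto; lra.
      * apply hv; auto.
    + intros i hi. unfold v. rewrite heig, hlv by auto. reflexivity.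
    + intros x hx. fold (lsum (fun i => inner x (v i)) v (seq 0 (b - a))).
      set (y := lsum _ _ _). apply vsub_eq0, vec_eq0_of_inner_self.
      assert (hres : forall i, (i < b - a)%nat -> inner (vsub H x y) (v i) = C0).
      { intros i hi; apply orthoz_residual; auto using seq_NoDup. apply in_seq; lia. }
      assert (hw : forall k, inner (vsub H x y) (u k) = C0).
      { intros k. destruct (Req_dec (lam k) mu) as [e|e].
        - apply hr in e. replace k with (a + (k - a))%nat by lia. apply hres; lia.
        - assert (h1 := hcoef mu x k hx e).
          assert (h2 : inner y (u k) = C0).
          { apply inner_lsum_0; intros i hi; apply in_seq in hi. apply (proj2 hu).
            intros e2; apply e; rewrite <- e2; apply hlv; lia. }
          inn; rewrite h1, h2. apply C_ext; simpl; ring. }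
      assert (h1 : inner x (vsub H x y) = C0) by (apply (hself mu); auto).
      assert (h2 : inner y (vsub H x y) = C0).
      { apply inner_lsum_0; intros i hi; apply in_seq in hi.
        apply inner_eq0_sym, hres; lia. }
      set (w := vsub H x y) in *. unfold w at 1, vsub.
      rewrite inner_addl, inner_oppl, h1, h2. apply C_ext; simpl; ring.
Qed.

(** On an eigenvector [u n] of [S T] with eigenvalue [mu n], the root multiplies by [sqrt (mu n)];
    on the complement of all [u n], both it and [S T] vanish. *)
Lemma abs_op_exists T S K : linear T -> nsq_bounded T K -> adjoint H T S -> seq_compact T ->
  exists P lam, abs_op H T P /\ sing_vals H P lam.
Proof.
  intros hT hK hS hc.
  set (A := fun x => S (T x)).
  assert (hSl := adjoint_linear T S hS). assert (hSb := adjoint_bounded T S K hS hK).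
  assert (hA : linear A).
  { split; intros; unfold A.
    - rewrite (proj1 hT), (proj1 hSl); reflexivity.
    - rewrite (proj2 hT), (proj2 hSl); reflexivity. }
  assert (hAb : nsq_bounded A (K * K)).
  { destruct hK as [h0 hK]; destruct hSb as [_ hSb]. split; [nra|]. intros x; unfold A.
    eapply Rle_trans; [apply hSb|]. rewrite Rmult_assoc.
    apply Rmult_le_compat_l; [lra|apply hK]. }
  assert (hAs : adjoint H A A).
  { intros x y; unfold A. rewrite (adjoint_sym T S) by auto. apply hS. }
  assert (hAp : forall x, 0 <= Re (inner (A x) x)).
  { intros x; unfold A. rewrite (adjoint_sym T S) by auto. apply nsq_ge0. }
  assert (hAc : seq_compact A).
  { apply (seq_compact_dominated A T K); auto; [apply hK|]. intros x; apply hSb. }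
  destruct (spectral_sequence A (K * K) hA hAb hAs hAp hAc)
    as [u [mu [hu [h01 [heig [hdec [hlim hker]]]]]]].
  assert (hmu0 : forall n, 0 <= mu n)
    by (intros n; destruct (h01 n) as [[_ h]|[_ h]]; lra).
  set (lam := fun n => sqrt (mu n)).
  assert (hl2 : forall n, lam n * lam n = mu n) by (intros; apply sqrt_sqrt; auto).
  assert (hdec' : forall n, lam (Datatypes.S n) <= lam n) by (intros; apply sqrt_le_1_alt; auto).
  assert (hlam : forall n, 0 <= lam n <= lam 0%nat).
  { intros n; split; [apply sqrt_pos|]. induction n as [|n IH]; [lra|].
    specialize (hdec' n); lra. }
  destruct (diagonal_operator u lam (lam 0%nat) hu hlam) as [P [hP [h1 h2]]].
  assert (hPs := positive_adjoint P hP).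
  exists P, lam; split; [split; auto|].
  - exists S; split; auto. intros x. apply (orth_decomposition_eq u).
    + intros k. rewrite !h1. change (S (T x)) with (A x). rewrite hAs, heig, inner_scalr.
      rewrite <- hl2. apply C_ext; simpl; ring.
    + intros z hz. rewrite h2 by auto. change (S (T x)) with (A x).
      rewrite hAs, hker, inner_0r by auto. reflexivity.
  - apply (diagonal_sing_vals u); auto.
    + intros n; destruct (h01 n) as [[h3 h4]|[h3 h4]]; unfold lam.
      * left; rewrite h4, sqrt_0; auto.
      * right; split; auto. apply sqrt_lt_R0; auto.
    + intros eps he. destruct (hlim (eps * eps)) as [N hN]; [nra|].
      exists N; intros n hn; specialize (hN n hn). unfold Rdist in *.
      rewrite Rminus_0_r in *. rewrite Rabs_pos_eq in * by auto.
      rewrite Rabs_pos_eq by apply hlam. rewrite <- hl2 in hN.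
      destruct (hlam n) as [h3 _]. nra.
    + intros n. apply (orth_decomposition_eq u).
      * intros k. rewrite h1, inner_scall.
        destruct (Nat.eq_dec n k) as [->|hnk]; auto.
        rewrite (proj2 hu n k) by auto. apply C_ext; simpl; ring.
      * intros z hz. rewrite h2, inner_scall, (inner_eq0_sym _ _ (hz n)) by auto.
        apply C_ext; simpl; ring.
Qed.

(** [sing_vals] offers a separate basis for each eigenspace; these are glued into one family,
    aligned with [lam] and zero where [lam] is. *)
Lemma sing_vectors P lam : adjoint H P P -> sing_vals H P lam ->
  exists u : nat -> H, orthoz u /\
    (forall n, u n = vzero /\ lam n = 0 \/ inner (u n) (u n) = C1 /\ 0 < lam n) /\
    (forall n, P (u n) = vscal (RtoC (lam n)) (u n)) /\
    (forall mu x, 0 < mu -> P x = vscal (RtoC mu) x ->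
       exists l, x = lsum (fun n => inner x (u n)) u l).
Proof.
  intros hs [hl0 [hdec [heig hmul]]].
  (* The basis is chosen for each value [mu], not for each index, so that indices with equal [lam]
     read the same basis, at offset [n - a]. *)
  destruct (choice (fun mu (q : nat * nat * (nat -> H)) =>
    0 < mu -> (exists n, lam n = mu) ->
    let '(a, k, v) := q in (forall n, lam n = mu <-> (a <= n < a + k)%nat) /\
    (forall i j, (i < k)%nat -> (j < k)%nat ->
        inner (v i) (v j) = if Nat.eqb i j then C1 else C0) /\
    (forall i, (i < k)%nat -> P (v i) = vscal (RtoC mu) (v i)) /\
    (forall x, P x = vscal (RtoC mu) x ->
        x = vsum H (map (fun i => vscal (inner x (v i)) (v i)) (seq 0 k))))) as [F hF].
  { intros mu. destruct (classic (0 < mu /\ exists n, lam n = mu)) as [[h1 h2]|h].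
    - destruct (hmul mu h1 h2) as [a [k [h3 [v h4]]]]. exists (a, k, v); auto.
    - exists (0%nat, 0%nat, fun _ => vzero); intros; exfalso; auto. }
  set (u := fun n => if Rlt_dec 0 (lam n) then
              let '(a, k, v) := F (lam n) in v (n - a)%nat else vzero).
  assert (hu0 : forall n, u n = vzero /\ lam n = 0 \/ inner (u n) (u n) = C1 /\ 0 < lam n).
  { intros n. unfold u. destruct (Rlt_dec 0 (lam n)) as [h|h].
    - right; split; auto. assert (h1 := hF (lam n) h (ex_intro _ n eq_refl)).
      destruct (F (lam n)) as [[a k] v]. destruct h1 as [h1 [h2 _]].
      assert (h3 := proj1 (h1 n) eq_refl). rewrite h2 by lia. rewrite Nat.eqb_refl; auto.
    - left; split; auto. specialize (hl0 n); lra. }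
  assert (hueig : forall n, P (u n) = vscal (RtoC (lam n)) (u n)).
  { intros n. unfold u. destruct (Rlt_dec 0 (lam n)) as [h|h].
    - assert (h1 := hF (lam n) h (ex_intro _ n eq_refl)).
      destruct (F (lam n)) as [[a k] v]. destruct h1 as [h1 [_ [h2 _]]].
      assert (h3 := proj1 (h1 n) eq_refl). apply h2; lia.
    - assert (e : lam n = 0) by (specialize (hl0 n); lra).
      rewrite e, vscal_0r. apply nsq_eq0.
      assert (h0 : P vzero = vzero).
      { apply inner_ext; intros z. rewrite hs, !inner_0l; reflexivity. }
      rewrite h0; apply nsq_0. }
  exists u; split; [split|split; [auto|split; [auto|]]].
  - intros n; destruct (hu0 n) as [[h _]|[h _]]; auto.
  - intros i j hij. destruct (Req_dec (lam i) (lam j)) as [e|e].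
    + unfold u. destruct (Rlt_dec 0 (lam i)) as [h|h]; [|apply inner_0l].
      rewrite e in h |- *. destruct (Rlt_dec 0 (lam j)) as [h'|h']; [|apply inner_0r].
      assert (h1 := hF (lam j) h (ex_intro _ j eq_refl)).
      destruct (F (lam j)) as [[a k] v]. destruct h1 as [h1 [h2 _]].
      assert (h3 := proj1 (h1 j) eq_refl). assert (h4 := proj1 (h1 i) e).
      rewrite h2 by lia. destruct (Nat.eqb_spec (i - a) (j - a)); auto. lia.
    + apply (eigenvalues_orth P (lam i) (lam j)); auto.
  - intros mu x hmu hx. destruct (classic (x = vzero)) as [->|hx0].
    { exists nil; reflexivity. }
    assert (hex : exists n, lam n = mu) by (apply heig; auto; exists x; auto).
    assert (h1 := hF mu hmu hex). destruct (F mu) as [[a k] v] eqn:eF.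
    destruct h1 as [h1 [_ [_ h2]]]. exists (map (fun i => (a + i)%nat) (seq 0 k)).
    rewrite (h2 x hx) at 1. unfold lsum; rewrite map_map. f_equal. apply map_ext_in.
    intros i hi; apply in_seq in hi.
    assert (e : lam (a + i)%nat = mu) by (apply h1; lia).
    assert (e2 : u (a + i)%nat = v i).
    { unfold u. rewrite e, eF. destruct (Rlt_dec 0 mu); [|lra]. f_equal; lia. }
    rewrite e2; reflexivity.
Qed.

(* A positive eigenvector found in the orthogonal complement of all positive
   eigenvectors would be orthogonal to itself. *)
Lemma sing_vectors_kernel P K lam (u : nat -> H) : linear P -> nsq_bounded P K ->
  adjoint H P P -> (forall x, 0 <= Re (inner (P x) x)) -> seq_compact P ->
  (forall mu x, 0 < mu -> P x = vscal (RtoC mu) x ->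
       exists l, x = lsum (fun n => inner x (u n)) u l) ->
  (forall n, P (u n) = vscal (RtoC (lam n)) (u n)) ->
  forall y, (forall n, inner y (u n) = C0) -> P y = vzero.
Proof.
  intros hl hb hs hp hc hspan heig y hy.
  set (U := fun v => exists mu, 0 < mu /\ P v = vscal (RtoC mu) v).
  destruct (top_eigenvector P K U hl hb hs hp hc) as [x [mu [h1 [h2 [h3 h4]]]]].
  { apply eigen_perp_invariant; auto. intros v [mu [_ h]]; eauto. }
  assert (hyU : perp U y).
  { intros v [t [ht hv]]. destruct (hspan t v ht hv) as [l ->].
    apply inner_eq0_sym, inner_lsum_0; intros; apply inner_eq0_sym; auto. }
  apply positive_form_eq0; auto.
  destruct h3 as [[_ ->]|[h3 h5]].
  - specialize (h4 y hyU); lra.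
  - exfalso. assert (h6 : inner x x = C0) by (apply h1; exists mu; auto).
    rewrite h3 in h6. assert (h7 := f_equal Re h6); simpl in h7; lra.
Qed.

End SingularValues.

(** * Real powers and Hoelder's inequality *)

Lemma rpow_0 (q : R) : rpow 0 q = 0.
Proof. unfold rpow; destruct (Rlt_dec 0 0); auto; lra. Qed.

Lemma rpow_pos (x q : R) : 0 < x -> rpow x q = Rpower x q.
Proof. intros h; unfold rpow; destruct (Rlt_dec 0 x); auto; lra. Qed.

Lemma rpow_1 (q : R) : rpow 1 q = 1.
Proof. rewrite rpow_pos by lra. unfold Rpower. rewrite ln_1, Rmult_0_r. apply exp_0. Qed.

Lemma rpow_ge0 (x q : R) : 0 <= rpow x q.
Proof.
  unfold rpow; destruct (Rlt_dec 0 x); [|lra]. unfold Rpower; apply Rlt_le, exp_pos.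
Qed.

Lemma rpow_le_Rpower (x y q : R) : 0 < y -> x <= y -> 0 <= q -> rpow x q <= Rpower y q.
Proof.
  intros hy hxy hq. unfold rpow; destruct (Rlt_dec 0 x).
  - apply Rle_Rpower_l; auto.
  - unfold Rpower; apply Rlt_le, exp_pos.
Qed.

(** Add [ln a <= a - 1] at [z / m] and at [1 / m] with weights [th] and [1 - th]; since [m] is the
    weighted mean, the right sides cancel. *)
Lemma Rpower_young (z th : R) : 0 < z -> 0 <= th <= 1 -> Rpower z th <= th * z + (1 - th).
Proof.
  intros hz hth. set (m := th * z + (1 - th)).
  assert (hm : 0 < m).
  { unfold m. destruct (Req_dec th 0) as [->|h]; [lra|].
    assert (0 < th * z) by (apply Rmult_lt_0_compat; lra). lra. }
  assert (hln : forall a, 0 < a -> ln a <= a - 1).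
  { intros a ha. assert (h := exp_ineq1_le (ln a)). rewrite exp_ln in h by auto. lra. }
  assert (h1 := hln (z / m) (Rdiv_lt_0_compat _ _ hz hm)).
  assert (h2 := hln (/ m) (Rinv_0_lt_compat _ hm)).
  unfold Rdiv in h1. rewrite ln_mult in h1 by (auto; apply Rinv_0_lt_compat; auto).
  rewrite ln_Rinv in h1, h2 by auto.
  assert (h3 : th * ln z <= ln m).
  { assert (e : th * (z * / m - 1) + (1 - th) * (/ m - 1) = 0) by (unfold m; field; fold m; lra).
    assert (h4 : th * (ln z + - ln m) <= th * (z * / m - 1)) by (apply Rmult_le_compat_l; lra).
    assert (h5 : (1 - th) * (- ln m) <= (1 - th) * (/ m - 1)) by (apply Rmult_le_compat_l; lra).
    lra. }
  unfold Rpower. rewrite <- (exp_ln m) by auto.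
  destruct h3 as [h3|h3]; [left; apply exp_increasing; auto | rewrite h3; lra].
Qed.

Lemma sqr_exp_ln (x : R) : 0 < x -> x * x = exp (2 * ln x).
Proof.
  intros h. replace (2 * ln x) with (ln x + ln x) by ring.
  rewrite exp_plus, exp_ln; auto.
Qed.

(** As a function of [x^2], the right side is the tangent line at [t^2] of the concave function
    [s^(p/2)]. *)
Lemma rpow_young (x t p : R) : 0 <= x -> 0 < t -> 0 < p <= 2 ->
  rpow x p <= p / 2 * Rpower t (p - 2) * (x * x) + (1 - p / 2) * Rpower t p.
Proof.
  intros hx ht hp. destruct (Req_dec x 0) as [->|hx0].
  - rewrite rpow_0, Rmult_0_l, Rmult_0_r, Rplus_0_l.
    apply Rmult_le_pos; [lra|]. apply Rlt_le, exp_pos.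
  - assert (hxp : 0 < x) by lra. rewrite rpow_pos by auto.
    set (z := exp (2 * ln x - 2 * ln t)).
    assert (h := Rpower_young z (p / 2) (exp_pos _) ltac:(lra)).
    assert (e1 : Rpower x p = Rpower t p * Rpower z (p / 2)).
    { unfold Rpower, z. rewrite ln_exp, <- exp_plus. f_equal; field. }
    assert (e2 : Rpower t (p - 2) * (x * x) = Rpower t p * z).
    { unfold Rpower, z. rewrite sqr_exp_ln, <- !exp_plus by auto. f_equal; ring. }
    rewrite e1. rewrite Rmult_assoc, e2.
    assert (ht0 : 0 < Rpower t p) by apply exp_pos.
    apply (Rmult_le_compat_l (Rpower t p)) in h; lra.
Qed.

Lemma fsum_term_le {I : Type} (a : I -> R) (l : list I) i :
  (forall j, 0 <= a j) -> In i l -> a i <= fsum a l.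
Proof.
  intros ha hi. replace (a i) with (fsum a (i :: nil)) by (simpl; ring).
  apply fsum_incl; auto.
  - repeat constructor; auto.
  - intros j [<-|[]]; auto.
Qed.

Lemma fsum_eq0 {I : Type} (a : I -> R) (l : list I) :
  (forall i, In i l -> a i = 0) -> fsum a l = 0.
Proof.
  intros h. rewrite (fsum_ext _ (fun _ => 0 * 0)) by (intros; rewrite h; auto; ring).
  rewrite fsum_scal; ring.
Qed.

(** With the point of tangency given by [t = X / Y], the two sums contribute at most [p / 2] and
    [1 - p / 2] times [Y^(2-p) X^p]. *)
Lemma holder_rpow {I : Type} (lam b : I -> R) (K : list I) (X Y p : R) : 0 < p <= 2 ->
  (forall k, 0 <= lam k) -> (forall k, 0 <= b k) -> 0 <= X -> 0 <= Y ->
  fsum (fun k => lam k * lam k * b k) K <= X * X -> fsum b K <= Y * Y ->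
  fsum (fun k => rpow (lam k) p * b k) K <= rpow Y (2 - p) * rpow X p.
Proof.
  intros hp hlam hb hX hY h1 h2.
  assert (hlb : forall k, 0 <= lam k * lam k * b k).
  { intros k; apply Rmult_le_pos; auto. apply Rmult_le_pos; auto. }
  (* For [Y = 0] or [X = 0] the ratio [t] is meaningless, and [rpow 0 q = 0], even for [q = 0],
     demands that the sum vanish. *)
  destruct (Req_dec Y 0) as [->|hY0].
  { rewrite fsum_eq0.
    - apply Rmult_le_pos; apply rpow_ge0.
    - intros k hk. assert (h := fsum_term_le b K k hb hk).
      replace (b k) with 0 by (specialize (hb k); lra). ring. }
  destruct (Req_dec X 0) as [->|hX0].
  { rewrite fsum_eq0.
    - apply Rmult_le_pos; apply rpow_ge0.
    - intros k hk. assert (h := fsum_term_le _ K k hlb hk). simpl in h.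
      assert (h0 : lam k * lam k * b k = 0) by (specialize (hlb k); lra).
      destruct (Rmult_integral _ _ h0) as [h3|h3]; [|rewrite h3; ring].
      replace (lam k) with 0 by (destruct (Rmult_integral _ _ h3); lra).
      rewrite rpow_0; ring. }
  assert (hXp : 0 < X) by lra. assert (hYp : 0 < Y) by lra.
  set (t := exp (ln X - ln Y)). assert (ht : 0 < t) by apply exp_pos.
  apply Rle_trans with (fsum (fun k => p / 2 * Rpower t (p - 2) * (lam k * lam k * b k)
                                       + (1 - p / 2) * Rpower t p * b k) K).
  { apply fsum_le; intros k _. assert (h := rpow_young (lam k) t p (hlam k) ht hp).
    apply (Rmult_le_compat_r (b k)) in h; auto. lra. }
  rewrite fsum_add, !fsum_scal.
  rewrite !rpow_pos by auto.
  assert (e1 : Rpower t (p - 2) * (X * X) = Rpower Y (2 - p) * Rpower X p).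
  { unfold Rpower, t. rewrite ln_exp, sqr_exp_ln, <- !exp_plus by auto. f_equal; ring. }
  assert (e2 : Rpower t p * (Y * Y) = Rpower Y (2 - p) * Rpower X p).
  { unfold Rpower, t. rewrite ln_exp, sqr_exp_ln, <- !exp_plus by auto. f_equal; ring. }
  assert (h3 : 0 <= p / 2 * Rpower t (p - 2))
    by (apply Rmult_le_pos; [lra|apply Rlt_le, exp_pos]).
  assert (h4 : 0 <= (1 - p / 2) * Rpower t p)
    by (apply Rmult_le_pos; [lra|apply Rlt_le, exp_pos]).
  apply (Rmult_le_compat_l _ _ _ h3) in h1. apply (Rmult_le_compat_l _ _ _ h4) in h2.
  replace (p / 2 * Rpower t (p - 2) * (X * X)) with (p / 2 * (Rpower Y (2 - p) * Rpower X p))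
    in h1 by (rewrite <- e1; ring).
  replace ((1 - p / 2) * Rpower t p * (Y * Y))
    with ((1 - p / 2) * (Rpower Y (2 - p) * Rpower X p)) in h2 by (rewrite <- e2; ring).
  lra.
Qed.

(** * Schatten classes, orthonormal bases and frames *)

Section Schatten.
Context {H : HilbertSpace}.
Implicit Types x y z : H.
Implicit Types T S P : H -> H.

(** Since [rpow 0 q = 0] for every [q], the term is 0 at [f i = 0] even when [p = 2]. *)
Definition frame_term {I : Type} (p : R) T (f : I -> H) (i : I) : R :=
  rpow (norm H (f i)) (2 - p) * rpow (norm H (T (f i))) p.

(** [P] and [lam] are arbitrary, so the bound holds for whichever pair witnesses the Schatten
    power. *)
Lemma sing_vals_sum_le {I : Type} (p : R) T P lam (f : I -> H) (c w : R) : 0 < p <= 2 ->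
  abs_op H T P -> sing_vals H P lam -> lower_bounded f c ->
  (forall L, NoDup L -> fsum (frame_term p T f) L <= w) ->
  forall K, NoDup K -> c * fsum (fun n => rpow (lam n) p) K <= w.
Proof.
  intros hp hPT hsv hf hw K hK.
  assert (hs := positive_adjoint P (proj1 hPT)).
  destruct (sing_vectors P lam hs hsv) as [u [hu [h01 [heig _]]]].
  (* The factor [nsq (u n)] is 1 except where [lam n = 0], and there the power is 0. *)
  rewrite (fsum_ext _ (fun n => rpow (lam n) p * nsq (u n))).
  - apply (weighted_lower_bound f c w u); auto; [intros; apply rpow_ge0|].
    intros L hL. eapply Rle_trans; [|apply (hw L hL)]. apply fsum_le; intros i _.
    apply (holder_rpow lam (fun k => Cmod2 (inner (u k) (f i)))); auto.
    + apply hsv.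
    + intros; apply Cmod2_ge0.
    + apply norm_ge0.
    + apply norm_ge0.
    (* [lam_k <f, u_k> = <P f, u_k>], so this is Bessel's inequality for [P f], whose norm is that
       of [T f]. *)
    + rewrite norm_sqr, <- (abs_op_nsq T P) by auto.
      eapply Rle_trans; [|apply (bessel u K (P (f i)) hu hK)].
      apply fsum_le; intros k _.
      rewrite hs, heig, inner_scalr, Cmod2_mul, (inner_conj _ (u k) (f i)), Cmod2_conj.
      unfold Cmod2; simpl. lra.
    + rewrite norm_sqr. eapply Rle_trans; [|apply (bessel u K (f i) hu hK)].
      apply fsum_le; intros k _. rewrite (inner_conj _ (u k) (f i)), Cmod2_conj. lra.
  - intros n _. destruct (h01 n) as [[_ h]|[h _]].
    + rewrite h, rpow_0; ring.
    + unfold nsq; rewrite h; simpl; ring.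
Qed.

(** [|T f|^2 = |T f|^(2-p) |T f|^p], and the first factor is at most [(sqrt K |f|)^(2-p)] because
    [p <= 2]. This turns the weighted sum into a Hilbert-Schmidt bound. *)
Lemma nsq_le_frame_term {I : Type} (p : R) T K (f : I -> H) i : 0 < p <= 2 ->
  nsq_bounded T K -> nsq (T (f i)) <= Rpower (sqrt K) (2 - p) * frame_term p T f i.
Proof.
  intros hp [hK hb]. assert (hC : 0 < Rpower (sqrt K) (2 - p)) by apply exp_pos.
  unfold frame_term. assert (h0 := norm_ge0 (T (f i))).
  destruct (Req_dec (norm H (T (f i))) 0) as [h|h].
  { rewrite <- norm_sqr, h, rpow_0. lra. }
  assert (h1 := norm_le_of_nsq _ _ _ hK (hb (f i))).
  assert (hs := sqrt_lt_R0 K hK).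
  assert (h2 : 0 < norm H (f i)).
  { destruct (Rle_lt_or_eq_dec _ _ (norm_ge0 (f i))) as [h2|h2]; auto.
    rewrite <- h2, Rmult_0_r in h1. lra. }
  rewrite !rpow_pos by lra. rewrite <- Rmult_assoc, Rpower_mult_distr by auto.
  rewrite <- norm_sqr. rewrite sqr_exp_ln by lra.
  replace (2 * ln (norm H (T (f i)))) with
    ((2 - p) * ln (norm H (T (f i))) + p * ln (norm H (T (f i)))) by ring.
  rewrite exp_plus. apply Rmult_le_compat_r; [apply Rlt_le, exp_pos|].
  apply (Rle_Rpower_l (norm H (T (f i))) _ (2 - p)); lra.
Qed.

Lemma frame_in_Sp {I : Type} (p : R) T (f : I -> H) (c w : R) : 0 < p <= 2 ->
  bounded_linear H T -> lower_bounded f c -> 0 < c ->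
  (forall L, NoDup L -> fsum (frame_term p T f) L <= w) -> in_Sp H p T.
Proof.
  intros hp hT hf hc hw. destruct (bounded_linear_nsq T hT) as [hl [K hK]].
  destruct (adjoint_exists T K hl hK) as [S hS].
  assert (hcpt : seq_compact T).
  { apply (frame_hilbert_schmidt T S K f c (Rpower (sqrt K) (2 - p) * w)); auto.
    intros l hl'.
    apply Rle_trans with (fsum (fun i => Rpower (sqrt K) (2 - p) * frame_term p T f i) l).
    - apply fsum_le; intros i _; apply nsq_le_frame_term; auto.
    - rewrite fsum_scal. apply Rmult_le_compat_l; [apply Rlt_le, exp_pos|auto]. }
  destruct (abs_op_exists T S K hl hK hS hcpt) as [P [lam [hP hsv]]].
  split; [apply compact_seq_compact; auto|]. exists P, lam; split; [auto|split; auto].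
  destruct (tsum_of_bound (fun n => rpow (lam n) p) (w / c)) as [s [hs _]]; [|exists s; auto].
  intros l hl'. assert (h := sing_vals_sum_le p T P lam f c w hp hP hsv hf hw l hl').
  apply (Rmult_le_reg_l c); auto. replace (c * (w / c)) with w by (field; lra). auto.
Qed.

(** The terms at the singular vectors are [lam_n^p]; those at the added vectors vanish because [P],
    hence [T], does there. *)
Lemma sing_vals_attained (p : R) T P lam : linear T ->
  compact H T -> abs_op H T P -> sing_vals H P lam ->
  exists f : nat -> H, orthoz f /\ total f /\
    forall s, tsum (fun n => rpow (norm H (T (f n))) p) s <->
              tsum (fun n => rpow (lam n) p) s.
Proof.
  intros hT hc hPT hsv. apply compact_seq_compact in hc.
  assert (hs := positive_adjoint P (proj1 hPT)).
  destruct (bounded_linear_nsq P (proj1 (proj1 hPT))) as [hPl [K hPK]].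
  assert (hn : forall x, nsq (P x) = nsq (T x)) by (intros; apply abs_op_nsq; auto).
  assert (hPc : seq_compact P).
  { apply (seq_compact_dominated P T 1); auto; [lra|]. intros x; rewrite hn; lra. }
  destruct (sing_vectors P lam hs hsv) as [u [hu [h01 [heig hspan]]]].
  assert (hker := sing_vectors_kernel P K lam u hPl hPK hs
                    (fun x => proj2 (proj2 (proj1 hPT) x)) hPc hspan heig).
  destruct (orthoz_extension_sum u hu) as [g [hw1 hw2]].
  set (w := fun s : nat + nat => match s with inl k => u k | inr k => g k end) in *.
  exists (fun n => w (nat_split n)); split; [|split].
  - apply orthoz_reindex; auto. apply nat_split_inj.
  - intros x hx; apply hw2; intros i. destruct (nat_split_surj i) as [n <-]; auto.
  - assert (hnorm : forall x, norm H (T x) = norm H (P x)).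
    { intros x; unfold norm. fold (nsq (T x)); rewrite <- hn; reflexivity. }
    intros s. rewrite <- (tsum_injection nat_split (fun i => rpow (norm H (T (w i))) p)).
    + apply (tsum_injection (@inl nat nat)).
      * congruence.
      * intros n; simpl. f_equal. rewrite hnorm, heig. unfold norm.
        change (Re (inner (vscal (RtoC (lam n)) (u n)) (vscal (RtoC (lam n)) (u n))))
          with (nsq (vscal (RtoC (lam n)) (u n))).
        rewrite nsq_scal; unfold Cmod2; simpl.
        destruct (h01 n) as [[_ h]|[h h']].
        -- rewrite h. replace ((0 * 0 + 0 * 0) * nsq (u n)) with 0 by ring. apply sqrt_0.
        -- unfold nsq; rewrite h; simpl.
           replace ((lam n * lam n + 0 * 0) * 1) with (lam n * lam n) by ring.
           apply sqrt_square; lra.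
      * intros [n|n] hj; [exfalso; apply (hj n); auto|]. simpl.
        rewrite hnorm, hker, norm_0; [apply rpow_0|].
        intros k; apply (proj2 hw1 (inr n) (inl k)); discriminate.
    + apply nat_split_inj.
    + auto.
    + intros j hj. destruct (nat_split_surj j) as [n hn']. exfalso; apply (hj n); auto.
Qed.

Lemma ONB_orthoz {I : Type} (e : I -> H) : ONB H e -> orthoz e /\ total e.
Proof. intros [h1 [h2 h3]]; split; [split|]; auto. Qed.

Lemma frame_term_unit {I : Type} (p : R) T (f : I -> H) i : linear T -> orthoz f ->
  frame_term p T f i = rpow (norm H (T (f i))) p.
Proof.
  intros hT hf. unfold frame_term. destruct (orthoz_nsq f i hf) as [h|h].
  - rewrite h, linear_0, norm_0, !rpow_0 by auto; ring.
  - replace (norm H (f i)) with 1; [rewrite rpow_1; ring|].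
    unfold norm; fold (nsq (f i)); rewrite h, sqrt_1; reflexivity.
Qed.

(** [ONB] asks for unit vectors, so zero members are removed; the index type is then finite if the
    dimension is. *)
Lemma orthoz_ONB (f : nat -> H) : orthoz f -> total f ->
  ONB H (fun i : {n : nat | f n <> vzero} => f (proj1_sig i)).
Proof.
  intros [h1 h2] h3; split; [|split].
  - intros [n hn]; simpl. destruct (h1 n); tauto.
  - intros [m hm] [n hn] hmn; simpl. apply h2; intros ->. apply hmn; f_equal.
    apply proof_irrelevance.
  - intros x hx; apply h3; intros n. destruct (classic (f n = vzero)) as [->|h].
    + apply inner_0r.
    + apply (hx (exist _ n h)).
Qed.

Lemma tsum_nonzero_members (p : R) T (f : nat -> H) s : linear T ->
  (tsum (fun n => rpow (norm H (T (f n))) p) s <->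
   tsum (fun i : {n : nat | f n <> vzero} => rpow (norm H (T (f (proj1_sig i)))) p) s).
Proof.
  intros hT. apply (tsum_injection (@proj1_sig nat (fun n => f n <> vzero))).
  - intros [m hm] [n hn]; simpl; intros ->. f_equal; apply proof_irrelevance.
  - auto.
  - intros n hn. destruct (classic (f n = vzero)) as [->|h].
    + rewrite linear_0, norm_0 by auto. apply rpow_0.
    + exfalso; apply (hn (exist _ n h)); reflexivity.
Qed.

Lemma frame_ineq_lower_bounded (f : nat -> H) c1 c2 :
  frame_ineq H f c1 c2 -> lower_bounded f c1.
Proof.
  intros hf x b hb. destruct (hf x) as [s [hs [h1 _]]]. rewrite norm_sqr in h1.
  apply (tsum_approx _ s); auto; lra.
Qed.

(** For [x = f n] the term of index [n] is [|f n|^4]. *)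
Lemma frame_ineq_nsq_le (f : nat -> H) c1 c2 n :
  0 < c2 -> frame_ineq H f c1 c2 -> nsq (f n) <= c2.
Proof.
  intros hc hf. destruct (hf (f n)) as [s [hs [_ h]]]. rewrite norm_sqr in h.
  assert (h1 := tsum_le _ _ (n :: nil) hs ltac:(repeat constructor; auto)).
  simpl in h1. rewrite inner_self in h1; unfold Cmod2 in h1; simpl in h1.
  assert (h2 := nsq_ge0 (f n)).
  destruct (Req_dec (nsq (f n)) 0) as [h3|h3]; [lra|].
  apply (Rmult_le_reg_r (nsq (f n))); lra.
Qed.

(** The supremum of the admissible lower constants is not known to be admissible, but [b < |x|^2]
    needs only some admissible constant above [b / |x|^2]. A nonzero vector bounds these constants,
    so the supremum exists. *)
Lemma frame_lower_ge1_bounded (f : nat -> H) : (exists x : H, x <> vzero) ->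
  frame_lower_ge1 H f -> lower_bounded f 1.
Proof.
  intros [x0 hx0] [[c1 [c2 [hc hf]]] hA] x b hb.
  assert (hn0 : 0 < nsq x0).
  { destruct (Rle_lt_or_eq_dec _ _ (nsq_ge0 x0)) as [h|h]; auto.
    exfalso; apply hx0, nsq_eq0; auto. }
  destruct (hf x0) as [s0 [hs0 _]].
  destruct (completeness (fun c1 => exists c2, 0 < c1 <= c2 /\ frame_ineq H f c1 c2))
    as [A hlub].
  { exists (s0 / nsq x0); intros d1 [d2 [_ hd]]. destruct (hd x0) as [s [hs [h _]]].
    rewrite (is_lub_u _ _ _ hs hs0), norm_sqr in h.
    apply (Rmult_le_reg_r (nsq x0)); auto.
    replace (s0 / nsq x0 * nsq x0) with s0 by (field; lra). auto. }
  { exists c1, c2; auto. }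
  assert (h1 : 1 <= A) by (apply hA; exact hlub).
  destruct (Rle_lt_or_eq_dec _ _ (nsq_ge0 x)) as [hx|hx].
  2: { exists nil; split; [constructor|]. simpl; lra. }
  destruct (classic (exists d1 d2, b / nsq x < d1 /\ 0 < d1 <= d2 /\ frame_ineq H f d1 d2))
    as [[d1 [d2 [h2 [_ h3]]]]|hno].
  - apply (frame_ineq_lower_bounded f d1 d2); auto.
    apply (Rmult_lt_compat_r (nsq x)) in h2; auto.
    replace (b / nsq x * nsq x) with b in h2 by (field; lra). auto.
  - exfalso. assert (h2 : A <= b / nsq x).
    { apply hlub; intros d1 [d2 hd]. destruct (Rle_lt_dec d1 (b / nsq x)); auto.
      exfalso; apply hno; exists d1, d2; tauto. }
    apply (Rmult_le_compat_r (nsq x)) in h2; [|lra].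
    replace (b / nsq x * nsq x) with b in h2 by (field; lra). nra.
Qed.

Lemma parseval_lower_ge1 (f : nat -> H) : parseval H f -> frame_lower_ge1 H f.
Proof.
  intros [h1 [h2 _]]; split; auto. intros A hA.
  rewrite (is_lub_u _ _ _ hA h2). lra.
Qed.

Lemma parseval_nsq_le1 (f : nat -> H) n : parseval H f -> nsq (f n) <= 1.
Proof.
  intros [_ [_ [_ h]]]. apply h. intros c2 [c1 [hc hf]].
  apply (frame_ineq_nsq_le f c1 c2); auto; lra.
Qed.

(** Testing on a nonzero vector forces [c1 <= 1 <= c2] for all admissible constants. *)
Lemma orthoz_parseval (f : nat -> H) : (exists x : H, x <> vzero) ->
  orthoz f -> total f -> parseval H f.
Proof.
  intros [x0 hx0] hu ht.
  assert (hn0 : 0 < nsq x0).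
  { destruct (Rle_lt_or_eq_dec _ _ (nsq_ge0 x0)) as [h|h]; auto.
    exfalso; apply hx0, nsq_eq0; auto. }
  assert (h1 : frame_ineq H f 1 1).
  { intros x; exists (nsq x); split; [apply parseval_tsum; auto|]. rewrite norm_sqr; lra. }
  assert (h2 : forall c1 c2, frame_ineq H f c1 c2 -> c1 <= 1 <= c2).
  { intros c1 c2 hf. destruct (hf x0) as [s [hs [h2 h3]]].
    rewrite (is_lub_u _ _ _ hs (parseval_tsum f x0 hu ht)), norm_sqr in *. nra. }
  split; [|split; split].
  - exists 1, 1; split; [lra|auto].
  - intros c1 [c2 [_ h]]; apply (h2 c1 c2); auto.
  - intros b hb; apply hb; exists 1; split; [lra|auto].
  - intros c2 [c1 [_ h]]; apply (h2 c1 c2); auto.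
  - intros b hb; apply hb; exists 1; split; [lra|auto].
Qed.

Lemma schatten_pow_le {I : Type} (p : R) T (f : I -> H) v (y : R) : 0 < p <= 2 ->
  bounded_linear H T -> lower_bounded f 1 -> schatten_pow H p T v ->
  (forall L, NoDup L -> fsum (frame_term p T f) L <= y) -> ole v (Some y).
Proof.
  intros hp hT hf hv hy. destruct v as [s|]; simpl.
  - destruct hv as [_ [P [lam [h1 [h2 h3]]]]]. apply h3. intros r [l [hl ->]].
    assert (h := sing_vals_sum_le p T P lam f 1 y hp h1 h2 hf hy l hl). lra.
  - apply hv. apply (frame_in_Sp p T f 1 y); auto; lra.
Qed.

(** Infinite competitors impose nothing; for [v = None] the first hypothesis excludes finite
    ones. *)
Lemma einf_attained (E : option R -> Prop) v :
  (forall y : R, E (Some y) -> ole v (Some y)) -> (forall s, v = Some s -> E (Some s)) ->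
  einf E v.
Proof.
  intros h1 h2; split.
  - intros [y|] hy; auto. destruct v; exact Logic.I.
  - intros u hu. destruct v as [s|]; [apply hu, h2; auto|]. destruct u; exact Logic.I.
Qed.

End Schatten.

Theorem theorem17 (H : HilbertSpace) (p : R) (T : H -> H) :
  (exists x : H, x <> vzero) ->
  0 < p <= 2 ->
  bounded_linear H T ->
  (* (a) <-> (b) <-> (c) *)
  ((in_Sp H p T <->
      exists (I : Type) (e : I -> H), ONB H e /\
        summable (fun i => rpow (norm H (T (e i))) p)) /\
   ((exists (I : Type) (e : I -> H), ONB H e /\
        summable (fun i => rpow (norm H (T (e i))) p)) <->
      exists f : nat -> H, frame H f /\
        summable (fun n => rpow (norm H (T (f n))) p))) /\
  (* ||T||_p^p as the three infima, in [0, +infinity] *)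
  (forall v : option R, schatten_pow H p T v ->
     einf (fun w => exists (I : Type) (e : I -> H), ONB H e /\
                      esum (fun i => rpow (norm H (T (e i))) p) w) v /\
     einf (fun w => exists f : nat -> H, frame_lower_ge1 H f /\
                      esum (fun n => rpow (norm H (f n)) (2 - p) *
                                     rpow (norm H (T (f n))) p) w) v /\
     einf (fun w => exists f : nat -> H, parseval H f /\
                      esum (fun n => rpow (norm H (T (f n))) p) w) v).
Proof.
  intros hne hp hT. assert (hl := proj1 (bounded_linear_nsq T hT)).
  assert (hONB : forall (I : Type) (e : I -> H) y, ONB H e ->
            tsum (fun i => rpow (norm H (T (e i))) p) y ->
            lower_bounded e 1 /\ forall L, NoDup L -> fsum (frame_term p T e) L <= y).
  { intros I e y he hy. destruct (ONB_orthoz e he) as [h1 h2].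
    split; [apply orthoz_total_lower_bounded; auto|]. intros L hL.
    rewrite (fsum_ext _ (fun i => rpow (norm H (T (e i))) p)).
    - apply (tsum_le _ _ _ hy hL).
    - intros; apply frame_term_unit; auto. }
  assert (hab : forall s, schatten_pow H p T (Some s) -> exists f : nat -> H,
            orthoz f /\ total f /\ tsum (fun n => rpow (norm H (T (f n))) p) s).
  { intros s [hc [P [lam [h1 [h2 h3]]]]].
    destruct (sing_vals_attained p T P lam hl hc h1 h2) as [f [hf [hf2 hf3]]].
    exists f; split; [auto|split; [auto|]]. apply hf3; auto. }
  assert (hSp : in_Sp H p T -> exists s, schatten_pow H p T (Some s)).
  { intros [hc [P [lam [h1 [h2 [s h3]]]]]]. exists s; split; auto. exists P, lam; auto. }
  assert (hba : (exists (I : Type) (e : I -> H), ONB H e /\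
        summable (fun i => rpow (norm H (T (e i))) p)) -> in_Sp H p T).
  { intros [I [e [he [y hy]]]]. destruct (hONB I e y he hy) as [h1 h2].
    apply (frame_in_Sp p T e 1 y); auto; lra. }
  assert (hONBex : in_Sp H p T -> exists (I : Type) (e : I -> H), ONB H e /\
        summable (fun i => rpow (norm H (T (e i))) p)).
  { intros h. destruct (hSp h) as [s hs]. destruct (hab s hs) as [f [h1 [h2 h3]]].
    eexists; eexists; split; [apply (orthoz_ONB f h1 h2)|]. exists s.
    apply tsum_nonzero_members; auto. }
  split; [split; split|].
  - exact hONBex.
  - exact hba.
  - intros h. destruct (hSp (hba h)) as [s hs]. destruct (hab s hs) as [f [h1 [h2 h3]]].
    exists f; split; [apply (orthoz_parseval f hne h1 h2)|]. exists s; auto.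
  (* Members of a frame have norm at most [sqrt c2], so inserting the weight [|f n|^(2-p)] costs a
     constant factor. *)
  - intros [f [[c1 [c2 [hc hf]]] [y hy]]]. apply hONBex.
    assert (hc2 : 0 < c2) by lra. assert (hs := sqrt_lt_R0 c2 hc2).
    apply (frame_in_Sp p T f c1 (Rpower (sqrt c2) (2 - p) * y)); auto.
    + apply (frame_ineq_lower_bounded f c1 c2); auto.
    + lra.
    + intros L hL. apply Rle_trans with
        (Rpower (sqrt c2) (2 - p) * fsum (fun n => rpow (norm H (T (f n))) p) L).
      * rewrite <- fsum_scal. apply fsum_le; intros n _. unfold frame_term.
        apply Rmult_le_compat_r; [apply rpow_ge0|]. apply rpow_le_Rpower; auto; [|lra].
        apply sqrt_le_1_alt. apply (frame_ineq_nsq_le f c1 c2); auto.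
      * apply Rmult_le_compat_l; [apply Rlt_le, exp_pos|]. apply (tsum_le _ _ _ hy hL).
  - intros v hv. split; [|split]; apply einf_attained.
    + intros y [I [e [he hy]]]. destruct (hONB I e y he hy) as [h1 h2].
      apply (schatten_pow_le p T e); auto.
    + intros s ->. destruct (hab s hv) as [f [h1 [h2 h3]]].
      eexists; eexists; split; [apply (orthoz_ONB f h1 h2)|]. apply tsum_nonzero_members; auto.
    + intros y [f [hf hy]]. apply (schatten_pow_le p T f); auto.
      * apply frame_lower_ge1_bounded; auto.
      * intros L hL; apply (tsum_le _ _ _ hy hL).
    + intros s ->. destruct (hab s hv) as [f [h1 [h2 h3]]].
      exists f; split; [apply parseval_lower_ge1, orthoz_parseval; auto|]. simpl.
      apply (tsum_injection (fun n : nat => n) _ (fun n => rpow (norm H (T (f n))) p)); auto.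
      * intros n; apply (frame_term_unit p T f n hl h1).
      * intros j hj; exfalso; apply (hj j); auto.
    + intros y [f [hf hy]]. apply (schatten_pow_le p T f); auto.
      * apply frame_lower_ge1_bounded; auto. apply parseval_lower_ge1; auto.
      * intros L hL. eapply Rle_trans; [|apply (tsum_le _ _ _ hy hL)].
        apply fsum_le; intros n _. unfold frame_term.
        assert (h0 := rpow_ge0 (norm H (T (f n))) p).
        (* Members of a Parseval frame have norm at most 1, so the weighted sum lies below the
           unweighted one. *)
        assert (h1 : rpow (norm H (f n)) (2 - p) <= 1).
        { rewrite <- (rpow_1 (2 - p)), (rpow_pos 1) by lra.
          apply rpow_le_Rpower; [lra| |lra]. rewrite <- sqrt_1.
          apply sqrt_le_1_alt, parseval_nsq_le1; auto. }
        nra.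
    + intros s ->. destruct (hab s hv) as [f [h1 [h2 h3]]].
      exists f; split; [apply orthoz_parseval|]; auto.
Qed.
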